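(* Let $f\colon[0,1]\times\mathbb R\to\mathbb R$ be continuous, and let $A,B\in\widehat{\Omega}[0,1]$ satisfy $\bigl|\int_0^1[A(s)-B(s)]\,ds\bigr|<1$. Then there exists $\lambda_0>0$ such that for every $\lambda\in\mathbb R$ with $|\lambda|\le\lambda_0$ the boundary value problem $x''(t)=-\lambda f(t,x(t))$, $t\in[0,1]$, $x(0)=\int_0^1A(s)\,dx(s)$, $x(1)=\int_0^1B(s)\,dx(s)$ has a solution.
   Context: Integrals in the boundary conditions are Riemann–Stieltjes integrals; a solution is a twice continuously differentiable $x\colon[0,1]\to\mathbb R$ satisfying the equation and the boundary conditions. For $\varepsilon>0$ and $a<b$, a bounded $A\colon[a,b]\to\mathbb R$ belongs to $\Omega_\varepsilon[a,b]$ if there exists $\delta>0$ such that $\sup_{t\le\tau\le\sigma\le s}|A(\sigma)-A(\tau)|\le\varepsilon$ whenever $t,s\in[a,b]$ and $0\le s-t\le\delta$. $\Omega[0,1]$ is the set of bounded $A\colon[0,1]\to\mathbb R$ such that for every $\varepsilon>0$ there is $a\in(0,1)$ with $A|_{[0,a]}\in\Omega_\varepsilon[0,a]$ and $A|_{[a,1]}$ of bounded (Jordan) variation on $[a,1]$. $\widehat{\Omega}[0,1]=\Omega[0,1]\cup C[0,1]\cup BV[0,1]$, where $BV[0,1]$ denotes functions of bounded variation on $[0,1]$. *)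

(* Defs.v *)
From Stdlib Require Import Reals.
From Coquelicot Require Import Coquelicot.
Open Scope R_scope.

Fixpoint fsum (n : nat) (F : nat -> R) : R :=
  match n with
  | O => 0
  | S m => fsum m F + F m
  end.

Definition is_partition (a b : R) (n : nat) (p : nat -> R) : Prop :=
  p O = a /\ p n = b /\ (forall i, (i < n)%nat -> p i <= p (S i)).

Definition is_tagging (n : nat) (p xi : nat -> R) : Prop :=
  forall i, (i < n)%nat -> p i <= xi i <= p (S i).

Definition RS_sum (A g : R -> R) (n : nat) (p xi : nat -> R) : R :=
  fsum n (fun i => A (xi i) * (g (p (S i)) - g (p i))).

Definition is_RS_integral (A g : R -> R) (a b I : R) : Prop :=
  forall eps, 0 < eps -> exists delta, 0 < delta /\
    forall n p xi, is_partition a b n p -> is_tagging n p xi ->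
      (forall i, (i < n)%nat -> p (S i) - p i < delta) ->
      Rabs (RS_sum A g n p xi - I) < eps.

Definition bounded_on (A : R -> R) (a b : R) : Prop :=
  exists M, forall t, a <= t <= b -> Rabs (A t) <= M.

Definition BV_on (A : R -> R) (a b : R) : Prop :=
  exists M, forall n p, is_partition a b n p ->
    fsum n (fun i => Rabs (A (p (S i)) - A (p i))) <= M.

Definition Omega_eps (eps : R) (A : R -> R) (a b : R) : Prop :=
  bounded_on A a b /\
  exists delta, 0 < delta /\
    forall t s, a <= t <= b -> a <= s <= b -> 0 <= s - t <= delta ->
      forall tau sigma, t <= tau -> tau <= sigma -> sigma <= s ->
        Rabs (A sigma - A tau) <= eps.

Definition Omega01 (A : R -> R) : Prop :=
  bounded_on A 0 1 /\
  forall eps, 0 < eps -> exists a, 0 < a < 1 /\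
    Omega_eps eps A 0 a /\ BV_on A a 1.

Definition C01 (A : R -> R) : Prop :=
  forall t, 0 <= t <= 1 ->
    filterlim A (within (fun s => 0 <= s <= 1) (locally t)) (locally (A t)).

Definition OmegaHat01 (A : R -> R) : Prop :=
  Omega01 A \/ C01 A \/ BV_on A 0 1.

Definition cont_strip (f : R -> R -> R) : Prop :=
  forall t y, 0 <= t <= 1 ->
    filterlim (fun q : R * R => f (fst q) (snd q))
      (within (fun q : R * R => 0 <= fst q <= 1) (locally (t, y)))
      (locally (f t y)).

(* x is a solution of x'' = -lambda f(t,x), x(0)=int A dx, x(1)=int B dx.
   x is taken C^2 on all of R (every C^2 function on [0,1] extends so). *)
Definition is_solution (f : R -> R -> R) (A B : R -> R) (lam : R) (x : R -> R) : Prop :=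
  (forall t, ex_derive x t /\ ex_derive (Derive x) t /\
             continuous (Derive (Derive x)) t) /\
  (forall t, 0 <= t <= 1 -> Derive (Derive x) t = - lam * f t (x t)) /\
  is_RS_integral A x 0 1 (x 0) /\
  is_RS_integral B x 0 1 (x 1).

(* Main.v *)
Require Import Defs.
From Stdlib Require Import ZArith Reals Lra Lia Classical ClassicalEpsilon.
From Coquelicot Require Import Coquelicot.
From mathcomp Require classical.filter.
Open Scope R_scope.

(** Discretise by Euler's scheme with step 1/n and take limits along a free
    ultrafilter U on nat, so that no subsequences need be extracted.  For fixed
    n the unknowns are the two initial values (p, q), and the discrete boundary
    conditions are two continuous equations in (p, q).  Adding them gives
    (1 + mean (A - B)) q = O(lambda), and 1 + mean (A - B) tends to
    1 + int (A - B) > 0; so for small lambda, with a bound independent of n,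
    the Poincare-Miranda theorem on a rectangle solves them.  The ultralimits of
    the Euler polygons and of their slopes are Lipschitz and satisfy the
    differential equation because f is continuous.  The boundary conditions
    survive because A and B have small oscillation sums on fine partitions, so
    that int A dx is the limit of the discrete sums. *)

(** * Limits along a free ultrafilter *)

(** As [f] is merely continuous, an initial value problem may have several solutions, so there is no
    continuous shooting map from initial data to boundary values. For fixed [n] Euler's scheme is a
    finite composition of continuous maps, and such a map exists. The scheme also makes
    [x_n = p + mean y] exact, so that [p = mean (A y)] and [x_n = mean (B y)] combine to
    [mean ((1 + A - B) y) = 0]; inserting [y = q + O(lambda)] isolates [q]. The rectangle comes from
    taking [|q| <= 1] and [|lambda| M <= 1]: then [|y| <= 2], hence [|mean (A y)| <= 2 K] for a
    common bound [K] of [A] and [B]; the choice [|p| <= 2 K + 1] leaves a margin of 1, and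
    [|x| <= 2 K + 3]. So [M] can be the maximum of [|f|] on that strip, fixed before [lambda]. What
    the three classes of [A] and [B] share is boundedness and Riemann integrability, which suffices
    for the integral against a Lipschitz [x]. *)

Lemma free_ultrafilter_exists :
  exists U : (nat -> Prop) -> Prop,
    (forall P, U P -> exists n, P n) /\ Filter U /\
    (forall N, U (fun n => (N <= n)%nat)) /\
    (forall P, U P \/ U (fun n => ~ P n)).
Proof.
  (* Extending the filter of eventual truth puts every tail into [G]; this is what makes the
     ultrafilter free. *)
  destruct (filter.ultraFilterLemma filter.eventually_filter) as [G [HG Hsub]].
  assert (HP : filter.ProperFilter G) by (apply HG).
  assert (HF : filter.Filter G) by (apply HP).
  assert (Himp : forall P Q : nat -> Prop, (forall n, P n -> Q n) -> G P -> G Q).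
  { intros P Q H; apply (@filter.filterS _ G HF P Q H). }
  exists G; repeat split.
  - intros P HPG; apply NNPP; intro Hn.
    apply (@filter.filter_not_empty _ G HP).
    refine (Himp P _ _ HPG); intros n Pn; apply Hn; exists n; exact Pn.
  - apply (@filter.filterT _ G HF).
  - intros P Q HPG HQG; apply (@filter.filterI _ G HF P Q HPG HQG).
  - intros P Q H; apply (Himp P Q H).
  - intro N; apply Hsub; exists N; [exact I|].
    intros n Hn; apply (ssrbool.elimT ssrnat.leP Hn).
  - intro P; apply (filter.in_ultra_setVsetC P HG).
Qed.

(** Fixed once, so that finitely many limits always run along the same indices and can be added,
    multiplied and compared. *)
Definition U : (nat -> Prop) -> Prop :=
  proj1_sig (constructive_indefinite_description _ free_ultrafilter_exists).

Global Instance U_proper : ProperFilter U.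
Proof.
  unfold U; destruct (constructive_indefinite_description _ _) as [V [H1 [H2 H3]]].
  constructor; assumption.
Qed.

Lemma U_and (P Q : nat -> Prop) : U P -> U Q -> U (fun n => P n /\ Q n).
Proof. apply filter_and. Qed.

Lemma U_ge (N : nat) : U (fun n => (N <= n)%nat).
Proof.
  unfold U; destruct (constructive_indefinite_description _ _) as [V [H1 [H2 [H3 H4]]]].
  apply H3.
Qed.

Lemma U_em (P : nat -> Prop) : U P \/ U (fun n => ~ P n).
Proof.
  unfold U; destruct (constructive_indefinite_description _ _) as [V [H1 [H2 [H3 H4]]]].
  apply H4.
Qed.

Definition is_ulim (u : nat -> R) (l : R) : Prop := filterlim u U (locally l).

Lemma is_ulim_eps (u : nat -> R) (l : R) :
  is_ulim u l <-> forall eps, 0 < eps -> U (fun n => Rabs (u n - l) < eps).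
Proof.
  unfold is_ulim; rewrite filterlim_locally; split.
  - intros H e He; exact (H (mkposreal e He)).
  - intros H e; apply (H e (cond_pos e)).
Qed.

Lemma is_ulim_ext (u v : nat -> R) (l : R) :
  U (fun n => u n = v n) -> is_ulim u l -> is_ulim v l.
Proof.
  intros H Hu; apply (filterlim_ext_loc u v); assumption.
Qed.

Lemma is_ulim_unique (u : nat -> R) (a b : R) :
  is_ulim u a -> is_ulim u b -> a = b.
Proof.
  intros Ha Hb; exact (filterlim_locally_unique (K := R_AbsRing) u a b Ha Hb).
Qed.

Lemma is_ulim_const (c : R) : is_ulim (fun _ => c) c.
Proof. apply filterlim_const. Qed.

Lemma is_ulim_plus (u v : nat -> R) (a b : R) :
  is_ulim u a -> is_ulim v b -> is_ulim (fun n => u n + v n) (a + b).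
Proof.
  intros Ha Hb.
  exact (filterlim_comp_2 u v Rplus Ha Hb (filterlim_plus (K := R_AbsRing) a b)).
Qed.

Lemma is_ulim_mult (u v : nat -> R) (a b : R) :
  is_ulim u a -> is_ulim v b -> is_ulim (fun n => u n * v n) (a * b).
Proof.
  intros Ha Hb.
  exact (filterlim_comp_2 u v Rmult Ha Hb (filterlim_mult (K := R_AbsRing) a b)).
Qed.

Lemma is_ulim_scal (c : R) (u : nat -> R) (a : R) :
  is_ulim u a -> is_ulim (fun n => c * u n) (c * a).
Proof. intro H; apply is_ulim_mult; [apply is_ulim_const | exact H]. Qed.

Lemma is_ulim_minus (u v : nat -> R) (a b : R) :
  is_ulim u a -> is_ulim v b -> is_ulim (fun n => u n - v n) (a - b).
Proof.
  intros Ha Hb; replace (a - b) with (a + -1 * b) by ring.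
  apply (is_ulim_ext (fun n => u n + -1 * v n)).
  - apply filter_forall; intro n; ring.
  - apply is_ulim_plus; [exact Ha | apply is_ulim_scal; exact Hb].
Qed.

Lemma is_ulim_le (u v : nat -> R) (a b : R) :
  U (fun n => u n <= v n) -> is_ulim u a -> is_ulim v b -> a <= b.
Proof.
  intros H Ha Hb.
  exact (filterlim_le (F := U) u v (Finite a) (Finite b) H Ha Hb).
Qed.

Lemma is_ulim_Rabs_le (u v : nat -> R) (a b : R) :
  U (fun n => Rabs (u n) <= v n) -> is_ulim u a -> is_ulim v b -> Rabs a <= b.
Proof.
  intros H Ha Hb; apply Rabs_le; split.
  - apply (is_ulim_le (fun n => -1 * v n) u); [|replace (-b) with (-1 * b) by ring; now apply is_ulim_scal|exact Ha].
    revert H; apply filter_imp; intros n Hn.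
    generalize (Rle_abs (- u n)); rewrite Rabs_Ropp; lra.
  - apply (is_ulim_le u v); [|exact Ha|exact Hb].
    revert H; apply filter_imp; intros n Hn; generalize (Rle_abs (u n)); lra.
Qed.

Lemma is_ulim_ge_const (u : nat -> R) (a c : R) :
  U (fun n => c <= u n) -> is_ulim u a -> c <= a.
Proof. intros H Ha; exact (is_ulim_le _ u c a H (is_ulim_const c) Ha). Qed.

Lemma is_ulim_le_const (u : nat -> R) (a c : R) :
  U (fun n => u n <= c) -> is_ulim u a -> a <= c.
Proof. intros H Ha; exact (is_ulim_le u _ a c H Ha (is_ulim_const c)). Qed.

(** Compactness of a bounded interval, where the alternative [U_em] enters. The limit is the
    supremum of the levels that [u] reaches on a [U]-large set: levels above it fail on such a set,
    levels below it hold on one. *)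
Lemma is_ulim_bounded (u : nat -> R) (a b : R) :
  U (fun n => a <= u n <= b) -> exists l, a <= l <= b /\ is_ulim u l.
Proof.
  intro H.
  destruct (completeness (fun r => U (fun n => r <= u n))) as [l [Hl1 Hl2]].
  - exists b; intros r Hr.
    destruct (filter_ex _ (U_and _ _ H Hr)) as [n Hn]; lra.
  - exists a; revert H; apply filter_imp; intros n Hn; lra.
  - assert (Hlim : is_ulim u l).
    { apply is_ulim_eps; intros e He.
      destruct (U_em (fun n => l + e / 2 <= u n)) as [H1|H1].
      { specialize (Hl1 _ H1); lra. }
      destruct (U_em (fun n => l - e / 2 <= u n)) as [H2|H2].
      - generalize (U_and _ _ H1 H2); apply filter_imp; intros n Hn.
        apply Rabs_def1; lra.
      - exfalso; assert (l <= l - e / 2); [|lra].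
        apply Hl2; intros r Hr.
        destruct (filter_ex _ (U_and _ _ H2 Hr)) as [n Hn]; lra. }
    exists l; split; [split|exact Hlim].
    + apply (is_ulim_ge_const u l a); [|exact Hlim].
      revert H; apply filter_imp; intros; lra.
    + apply (is_ulim_le_const u l b); [|exact Hlim].
      revert H; apply filter_imp; intros; lra.
Qed.

Lemma is_ulim_inv_INR : is_ulim (fun n => / INR n) 0.
Proof.
  apply is_ulim_eps; intros e He.
  destruct (archimed_cor1 e He) as [N [HN HN0]].
  generalize (U_ge N); apply filter_imp; intros n Hn.
  assert (0 < INR N) by (apply lt_0_INR; lia).
  assert (INR N <= INR n) by (apply le_INR; lia).
  rewrite Rminus_0_r, Rabs_pos_eq; [|left; apply Rinv_0_lt_compat; lra].
  apply Rle_lt_trans with (/ INR N); [apply Rinv_le_contravar; lra | exact HN].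
Qed.

Lemma U_inv_INR_lt (e : R) : 0 < e -> U (fun n => / INR n < e).
Proof.
  intro He; generalize (proj1 (is_ulim_eps _ _) is_ulim_inv_INR e He).
  apply filter_imp; intros n Hn; generalize (Rle_abs (/ INR n - 0)); lra.
Qed.

Lemma U_INR_pos : U (fun n => 0 < INR n).
Proof.
  generalize (U_ge 1); apply filter_imp; intros n Hn; apply lt_0_INR; lia.
Qed.

(** * Means over the grid k/n *)

Lemma fsum_ext (n : nat) (F G : nat -> R) :
  (forall i, (i < n)%nat -> F i = G i) -> fsum n F = fsum n G.
Proof.
  induction n as [|n IH]; intro H; simpl; [reflexivity|].
  rewrite IH, (H n); auto.
Qed.

Lemma fsum_plus (n : nat) (F G : nat -> R) :
  fsum n (fun i => F i + G i) = fsum n F + fsum n G.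
Proof. induction n as [|n IH]; simpl; [|rewrite IH]; ring. Qed.

Lemma fsum_scal (n : nat) (c : R) (F : nat -> R) :
  fsum n (fun i => c * F i) = c * fsum n F.
Proof. induction n as [|n IH]; simpl; [|rewrite IH]; ring. Qed.

Lemma fsum_minus (n : nat) (F G : nat -> R) :
  fsum n (fun i => F i - G i) = fsum n F - fsum n G.
Proof. induction n as [|n IH]; simpl; [|rewrite IH]; ring. Qed.

Lemma fsum_le (n : nat) (F G : nat -> R) :
  (forall i, (i < n)%nat -> F i <= G i) -> fsum n F <= fsum n G.
Proof.
  induction n as [|n IH]; intro H; simpl; [lra|].
  apply Rplus_le_compat; auto.
Qed.

Lemma fsum_0 (n : nat) : fsum n (fun _ => 0) = 0.
Proof. induction n as [|n IH]; simpl; [|rewrite IH]; ring. Qed.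

Lemma fsum_const (n : nat) (c : R) : fsum n (fun _ => c) = INR n * c.
Proof. induction n as [|n IH]; [simpl; ring|]. rewrite S_INR; simpl; rewrite IH; ring. Qed.

Lemma fsum_telescope (n : nat) (p : nat -> R) :
  fsum n (fun i => p (S i) - p i) = p n - p O.
Proof. induction n as [|n IH]; simpl; [|rewrite IH]; ring. Qed.

Lemma fsum_Rabs (n : nat) (F : nat -> R) :
  Rabs (fsum n F) <= fsum n (fun i => Rabs (F i)).
Proof.
  induction n as [|n IH]; simpl; [rewrite Rabs_R0; lra|].
  eapply Rle_trans; [apply Rabs_triang|]; lra.
Qed.

Lemma fsum_exchange (n m : nat) (F : nat -> nat -> R) :
  fsum n (fun i => fsum m (F i)) = fsum m (fun j => fsum n (fun i => F i j)).
Proof.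
  induction n as [|n IH]; simpl; [now rewrite fsum_0|].
  rewrite IH, <- fsum_plus; reflexivity.
Qed.

Lemma fsum_between (m1 m2 : nat) (F : nat -> R) (C : R) :
  (m1 <= m2)%nat -> (forall k, (m1 <= k < m2)%nat -> Rabs (F k) <= C) ->
  Rabs (fsum m2 F - fsum m1 F) <= (INR m2 - INR m1) * C.
Proof.
  intro H; induction H as [|m2 H IH]; intro HF.
  - rewrite !Rminus_diag, Rabs_R0; lra.
  - rewrite S_INR; simpl.
    replace (fsum m2 F + F m2 - fsum m1 F) with ((fsum m2 F - fsum m1 F) + F m2) by ring.
    eapply Rle_trans; [apply Rabs_triang|].
    assert (Rabs (F m2) <= C) by (apply HF; lia).
    assert (Rabs (fsum m2 F - fsum m1 F) <= (INR m2 - INR m1) * C)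
      by (apply IH; intros; apply HF; lia).
    lra.
Qed.

Lemma fsum_bound (n : nat) (F : nat -> R) (C : R) :
  (forall k, (k < n)%nat -> Rabs (F k) <= C) -> Rabs (fsum n F) <= INR n * C.
Proof.
  intro H; generalize (fsum_between 0 n F C (Nat.le_0_l n)).
  simpl; rewrite !Rminus_0_r; intro H1; apply H1; intros; apply H; lia.
Qed.

Definition mean (n : nat) (F : nat -> R) : R := / INR n * fsum n F.

Lemma mean_bound (n : nat) (F : nat -> R) (C : R) :
  (0 < n)%nat -> (forall k, (k < n)%nat -> Rabs (F k) <= C) -> Rabs (mean n F) <= C.
Proof.
  intros Hn H; unfold mean.
  assert (0 < INR n) by (apply lt_0_INR; lia).
  assert (0 < / INR n) by (apply Rinv_0_lt_compat; lra).
  rewrite Rabs_mult, (Rabs_pos_eq (/ INR n)) by lra.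
  replace C with (/ INR n * (INR n * C)) by (field; lra).
  apply Rmult_le_compat_l; [lra | apply fsum_bound; exact H].
Qed.

Lemma grid_in_01 (n k : nat) : (k <= n)%nat -> 0 <= INR k / INR n <= 1.
Proof.
  intros Hk; destruct (Nat.eq_0_gt_0_cases n) as [->|Hn].
  { replace k with O by lia; simpl; lra. }
  assert (0 < INR n) by (apply lt_0_INR; lia).
  assert (INR k <= INR n) by (apply le_INR; lia); split.
  - apply Rdiv_le_0_compat; [apply pos_INR | lra].
  - apply Rmult_le_reg_r with (INR n); [lra|].
    replace (INR k / INR n * INR n) with (INR k) by (field; lra); lra.
Qed.

(** [up r] is the floor of [r] plus 1, so this is the ceiling of [n t]. For [n > 0] and nonnegative
    [s], [t], the indices from [ceil_index n s] up to but excluding [ceil_index n t] are exactly the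
    [k] with [s <= k / n < t]; with the floor, the first one could lie to the left of [s]. *)
Definition ceil_index (n : nat) (t : R) : nat := Z.to_nat (1 - up (- (INR n * t))).

Lemma ceil_index_spec (n : nat) (t : R) :
  0 <= t -> INR n * t <= INR (ceil_index n t) < INR n * t + 1.
Proof.
  intro Ht; unfold ceil_index.
  assert (Hnt : 0 <= INR n * t) by (apply Rmult_le_pos; [apply pos_INR | exact Ht]).
  destruct (archimed (- (INR n * t))) as [H1 H2].
  assert (Hz : (0 <= 1 - up (- (INR n * t)))%Z).
  { assert (up (- (INR n * t)) < 2)%Z; [|lia].
    apply lt_IZR; lra. }
  rewrite (INR_IZR_INZ (Z.to_nat _)), Z2Nat.id, minus_IZR by exact Hz; lra.
Qed.

Lemma ceil_index_0 (n : nat) : ceil_index n 0 = O.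
Proof.
  destruct (ceil_index_spec n 0 (Rle_refl 0)) as [_ H].
  rewrite Rmult_0_r, Rplus_0_l in H; change 1 with (INR 1) in H.
  apply INR_lt in H; lia.
Qed.

Lemma ceil_index_1 (n : nat) : ceil_index n 1 = n.
Proof.
  destruct (ceil_index_spec n 1 Rle_0_1) as [H1 H2].
  rewrite Rmult_1_r in H1, H2; rewrite <- S_INR in H2.
  apply INR_le in H1; apply INR_lt in H2; lia.
Qed.

Lemma ceil_index_le (n : nat) (s t : R) :
  0 <= s <= t -> (ceil_index n s <= ceil_index n t)%nat.
Proof.
  intros [Hs Hst].
  destruct (ceil_index_spec n s Hs) as [_ H1].
  destruct (ceil_index_spec n t (Rle_trans _ _ _ Hs Hst)) as [H2 _].
  assert (INR n * s <= INR n * t) by (apply Rmult_le_compat_l; [apply pos_INR | exact Hst]).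
  assert (H3 : INR (ceil_index n s) < INR (S (ceil_index n t))) by (rewrite S_INR; lra).
  apply INR_lt in H3; lia.
Qed.

Lemma ceil_index_le_n (n : nat) (t : R) : 0 <= t <= 1 -> (ceil_index n t <= n)%nat.
Proof. intro H; rewrite <- (ceil_index_1 n) at 2; apply ceil_index_le; exact H. Qed.

Lemma ceil_index_between (n k : nat) (s t : R) :
  0 <= s -> 0 <= t -> (0 < n)%nat -> (ceil_index n s <= k < ceil_index n t)%nat ->
  s <= INR k / INR n <= t.
Proof.
  intros Hs Ht Hn [H1 H2].
  assert (0 < INR n) by (apply lt_0_INR; lia).
  destruct (ceil_index_spec n s Hs) as [H3 _].
  destruct (ceil_index_spec n t Ht) as [_ H4].
  apply le_INR in H1; assert (INR (S k) <= INR (ceil_index n t)) by (apply le_INR; lia).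
  rewrite S_INR in *.
  split.
  - apply Rmult_le_reg_r with (INR n); [assumption|].
    replace (INR k / INR n * INR n) with (INR k) by (field; lra); lra.
  - apply Rmult_le_reg_r with (INR n); [assumption|].
    replace (INR k / INR n * INR n) with (INR k) by (field; lra); lra.
Qed.

Lemma is_ulim_ceil_index (t : R) :
  0 <= t -> is_ulim (fun n => INR (ceil_index n t) / INR n) t.
Proof.
  intro Ht; apply is_ulim_eps; intros e He.
  generalize (U_and _ _ (U_inv_INR_lt e He) U_INR_pos); apply filter_imp.
  intros n [H1 H2].
  destruct (ceil_index_spec n t Ht) as [H3 H4].
  assert (H5 : INR (ceil_index n t) / INR n = t + (INR (ceil_index n t) - INR n * t) * / INR n)
    by (field; lra).
  rewrite H5.
  assert (0 < / INR n) by (apply Rinv_0_lt_compat; lra).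
  rewrite Rabs_pos_eq; nra.
Qed.

(** A discrete primitive: the integral from 0 to [t] of the step function equal to [F k] on the cell
    starting at [k / n], every cell that starts before [t] being counted in full. *)
Definition partial_mean (n : nat) (F : nat -> R) (t : R) : R :=
  / INR n * fsum (ceil_index n t) F.

Lemma partial_mean_0 (n : nat) (F : nat -> R) : partial_mean n F 0 = 0.
Proof. unfold partial_mean; rewrite ceil_index_0; simpl; ring. Qed.

Lemma partial_mean_1 (n : nat) (F : nat -> R) : partial_mean n F 1 = mean n F.
Proof. unfold partial_mean; rewrite ceil_index_1; reflexivity. Qed.

Lemma partial_mean_bounded (n : nat) (F : nat -> R) (t C : R) :
  0 <= t <= 1 -> (0 < n)%nat -> (forall k, (k < n)%nat -> Rabs (F k) <= C) ->
  Rabs (partial_mean n F t) <= C.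
Proof.
  intros Ht Hn H; unfold partial_mean.
  assert (0 < INR n) by (apply lt_0_INR; lia).
  assert (0 < / INR n) by (apply Rinv_0_lt_compat; lra).
  assert (Hc := ceil_index_le_n n t Ht).
  assert (0 <= C) by (eapply Rle_trans; [apply Rabs_pos | apply (H O); lia]).
  rewrite Rabs_mult, (Rabs_pos_eq (/ INR n)) by lra.
  replace C with (/ INR n * (INR n * C)) by (field; lra).
  apply Rmult_le_compat_l; [lra|].
  apply Rle_trans with (INR (ceil_index n t) * C).
  - apply fsum_bound; intros; apply H; lia.
  - apply Rmult_le_compat_r; [assumption | apply le_INR; exact Hc].
Qed.

Lemma partial_mean_ulim_exists (G : nat -> nat -> R) (C t : R) :
  0 <= t <= 1 -> (forall n k, (k < n)%nat -> Rabs (G n k) <= C) ->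
  exists l, is_ulim (fun n => partial_mean n (G n) t) l.
Proof.
  intros Ht H; destruct (is_ulim_bounded (fun n => partial_mean n (G n) t) (-C) C) as [l [_ Hl]].
  - generalize (U_ge 1); apply filter_imp; intros n Hn.
    apply Rabs_le_between, partial_mean_bounded; auto.
  - exists l; exact Hl.
Qed.

(** The increment is [/ n] times a sum over the grid points in [[s, t]], whose number divided by [n]
    tends to [t - s]; the offset [P n] cancels. It is used with [c] a slope to differentiate the
    limits, and with [c = 0] to compare a Riemann-Stieltjes sum with its integral. *)
Lemma partial_mean_increment (G : nat -> nat -> R) (P : nat -> R) (s t a b c e : R) :
  0 <= s <= t ->
  is_ulim (fun n => P n + partial_mean n (G n) s) a ->
  is_ulim (fun n => P n + partial_mean n (G n) t) b ->
  U (fun n => forall k, (k < ceil_index n t)%nat -> s <= INR k / INR n <= t ->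
     Rabs (G n k - c) <= e) ->
  Rabs (b - a - c * (t - s)) <= (t - s) * e.
Proof.
  intros Hst Ha Hb H.
  set (dm n := INR (ceil_index n t) / INR n - INR (ceil_index n s) / INR n).
  assert (Hd : is_ulim dm (t - s)).
  { apply is_ulim_minus; apply is_ulim_ceil_index; lra. }
  apply (is_ulim_Rabs_le
    (fun n => P n + partial_mean n (G n) t - (P n + partial_mean n (G n) s) - c * dm n)
    (fun n => dm n * e)).
  - generalize (U_and _ _ H (U_ge 1)); apply filter_imp; intros n [HG Hn].
    assert (0 < INR n) by (apply lt_0_INR; lia).
    assert (0 < / INR n) by (apply Rinv_0_lt_compat; lra).
    set (m1 := ceil_index n s); set (m2 := ceil_index n t).
    assert (Hm : (m1 <= m2)%nat) by (apply ceil_index_le; exact Hst).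
    assert (Hb' := fsum_between m1 m2 (fun k => G n k - c) e Hm).
    rewrite !fsum_minus, !fsum_const in Hb'.
    replace (P n + partial_mean n (G n) t - (P n + partial_mean n (G n) s) - c * dm n)
      with (/ INR n * (fsum m2 (G n) - INR m2 * c - (fsum m1 (G n) - INR m1 * c)))
      by (unfold partial_mean, dm; fold m1 m2; field; lra).
    replace (dm n * e) with (/ INR n * ((INR m2 - INR m1) * e))
      by (unfold dm; fold m1 m2; field; lra).
    rewrite Rabs_mult, (Rabs_pos_eq (/ INR n)) by lra.
    apply Rmult_le_compat_l; [lra|].
    apply Hb'; intros k Hk; apply HG; [unfold m2 in Hk; lia|].
    apply ceil_index_between; try lra; try lia; exact Hk.
  - apply is_ulim_minus; [apply is_ulim_minus; assumption | apply is_ulim_scal; exact Hd].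
  - apply (is_ulim_ext (fun n => e * dm n)); [apply filter_forall; intro; ring|].
    rewrite Rmult_comm; apply is_ulim_scal; exact Hd.
Qed.

(** * Oscillation sums and Riemann-Stieltjes integrals *)

(** For bounded [A] this is Darboux's criterion of Riemann integrability. Two arbitrary tags per
    interval replace the difference of supremum and infimum. *)
Definition osc_small (A : R -> R) : Prop :=
  forall eps, 0 < eps -> exists delta, 0 < delta /\
    forall n p xi eta, is_partition 0 1 n p -> is_tagging n p xi -> is_tagging n p eta ->
      (forall i, (i < n)%nat -> p (S i) - p i < delta) ->
      fsum n (fun i => Rabs (A (xi i) - A (eta i)) * (p (S i) - p i)) < eps.

Lemma partition_mono (a b : R) (n : nat) (p : nat -> R) (i j : nat) :
  is_partition a b n p -> (i <= j <= n)%nat -> p i <= p j.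
Proof.
  intros [_ [_ H]] [Hij Hjn]; induction Hij as [|j Hij IH]; [lra|].
  apply Rle_trans with (p j); [apply IH; lia | apply H; lia].
Qed.

Lemma partition_range (a b : R) (n : nat) (p : nat -> R) (i : nat) :
  is_partition a b n p -> (i <= n)%nat -> a <= p i <= b.
Proof.
  intros Hp Hi; destruct (Hp) as [<- [<- _]].
  split; eapply partition_mono; eauto; lia.
Qed.

Lemma osc_small_minus (A B : R -> R) :
  osc_small A -> osc_small B -> osc_small (fun s => A s - B s).
Proof.
  intros HA HB e He.
  destruct (HA (e / 2)) as [d1 [Hd1 H1]]; [lra|].
  destruct (HB (e / 2)) as [d2 [Hd2 H2]]; [lra|].
  exists (Rmin d1 d2); split; [apply Rmin_pos; assumption|].
  intros n p xi eta Hp Hxi Heta Hm.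
  assert (Ha := H1 n p xi eta Hp Hxi Heta
    (fun i Hi => Rlt_le_trans _ _ _ (Hm i Hi) (Rmin_l d1 d2))).
  assert (Hb := H2 n p xi eta Hp Hxi Heta
    (fun i Hi => Rlt_le_trans _ _ _ (Hm i Hi) (Rmin_r d1 d2))).
  replace e with (e / 2 + e / 2) by field.
  eapply Rle_lt_trans; [|exact (Rplus_lt_compat _ _ _ _ Ha Hb)].
  rewrite <- fsum_plus; apply fsum_le; intros i Hi.
  rewrite <- Rmult_plus_distr_r; apply Rmult_le_compat_r.
  - destruct Hp as [_ [_ Hp]]; specialize (Hp i Hi); lra.
  - replace (A (xi i) - B (xi i) - (A (eta i) - B (eta i)))
      with ((A (xi i) - A (eta i)) + - (B (xi i) - B (eta i))) by ring.
    eapply Rle_trans; [apply Rabs_triang|]; rewrite Rabs_Ropp; lra.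
Qed.

Lemma unif_cont_osc_small (A : R -> R) :
  (forall eps, 0 < eps -> exists delta, 0 < delta /\
     forall s t, 0 <= s <= 1 -> 0 <= t <= 1 -> Rabs (s - t) < delta -> Rabs (A s - A t) < eps) ->
  osc_small A.
Proof.
  intros H e He; destruct (H (e / 2)) as [d [Hd Hu]]; [lra|].
  exists d; split; [exact Hd|]; intros n p xi eta Hp Hxi Heta Hm.
  apply Rle_lt_trans with (fsum n (fun i => e / 2 * (p (S i) - p i))).
  - apply fsum_le; intros i Hi.
    assert (H1 := partition_range _ _ _ _ i Hp ltac:(lia)).
    assert (H2 := partition_range _ _ _ _ (S i) Hp ltac:(lia)).
    specialize (Hxi i Hi); specialize (Heta i Hi); specialize (Hm i Hi).
    apply Rmult_le_compat_r; [lra|]; left; apply Hu; try lra.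
    apply Rabs_def1; lra.
  - rewrite fsum_scal, fsum_telescope.
    destruct Hp as [-> [-> _]]; lra.
Qed.

(** Heine's theorem: bad pairs at distance below [/ (n + 1)] have a common ultralimit in [[0, 1]],
    and continuity there contradicts the gap [e]. *)
Lemma C01_unif_cont (A : R -> R) :
  C01 A ->
  forall eps, 0 < eps -> exists delta, 0 < delta /\
    forall s t, 0 <= s <= 1 -> 0 <= t <= 1 -> Rabs (s - t) < delta -> Rabs (A s - A t) < eps.
Proof.
  intros HA e He; apply NNPP; intro Hn.
  assert (Hbad : forall n : nat, exists st : R * R,
    0 <= fst st <= 1 /\ 0 <= snd st <= 1 /\
    Rabs (fst st - snd st) < / INR (S n) /\ e <= Rabs (A (fst st) - A (snd st))).
  { intro n; apply NNPP; intro H; apply Hn.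
    exists (/ INR (S n)); split; [apply Rinv_0_lt_compat, lt_0_INR; lia|].
    intros s t Hs Ht Hst; apply Rnot_le_lt; intro Hle.
    apply H; exists (s, t); auto. }
  destruct (choice _ Hbad) as [st Hst].
  destruct (is_ulim_bounded (fun n => fst (st n)) 0 1) as [l [Hl Hlim]].
  { apply filter_forall; intro n; apply Hst. }
  assert (Hlim' : is_ulim (fun n => snd (st n)) l).
  { apply is_ulim_eps; intros d Hd.
    generalize (U_and _ _ (U_inv_INR_lt (d / 2) ltac:(lra))
      (U_and _ _ U_INR_pos (proj1 (is_ulim_eps _ _) Hlim (d / 2) ltac:(lra)))).
    apply filter_imp; intros n [H1 [H2 H3]].
    destruct (Hst n) as [_ [_ [H4 _]]].
    assert (/ INR (S n) <= / INR n) by (apply Rinv_le_contravar; [lra | rewrite S_INR; lra]).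
    apply Rabs_def2 in H3; apply Rabs_def2 in H4; apply Rabs_def1; lra. }
  assert (HAl := proj1 (filterlim_locally _ _) (HA l Hl) (mkposreal (e / 2) ltac:(lra))).
  assert (K : forall u : nat -> R, (forall n, 0 <= u n <= 1) -> is_ulim u l ->
    U (fun n => Rabs (A (u n) - A l) < e / 2)).
  { intros u Hu Hul.
    assert (H : U (fun n => 0 <= u n <= 1 -> Rabs (A (u n) - A l) < e / 2)) by exact (Hul _ HAl).
    revert H; apply filter_imp; auto. }
  destruct (filter_ex _ (U_and _ _
    (K (fun n => fst (st n)) ltac:(intro; apply Hst) Hlim)
    (K (fun n => snd (st n)) ltac:(intro; apply Hst) Hlim'))) as [n [H1 H2]].
  destruct (Hst n) as [_ [_ [_ H3]]].
  apply Rabs_def2 in H1; apply Rabs_def2 in H2.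
  assert (Rabs (A (fst (st n)) - A (snd (st n))) < e) by (apply Rabs_def1; lra); lra.
Qed.

Lemma C01_bounded (A : R -> R) : C01 A -> bounded_on A 0 1.
Proof.
  intro HA; apply NNPP; intro Hn.
  assert (Hbad : forall n : nat, exists t, 0 <= t <= 1 /\ INR n < Rabs (A t)).
  { intro n; apply NNPP; intro H; apply Hn; exists (INR n); intros t Ht.
    apply Rnot_lt_le; intro Hlt; apply H; exists t; auto. }
  destruct (choice _ Hbad) as [u Hu].
  destruct (is_ulim_bounded u 0 1) as [l [Hl Hlim]].
  { apply filter_forall; intro n; apply Hu. }
  assert (HAl : U (fun n => 0 <= u n <= 1 -> Rabs (A (u n) - A l) < 1))
    by exact (Hlim _ (proj1 (filterlim_locally _ _) (HA l Hl) (mkposreal 1 Rlt_0_1))).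
  destruct (nfloor_ex (Rabs (A l) + 1)) as [N HN]; [generalize (Rabs_pos (A l)); lra|].
  destruct (filter_ex _ (U_and _ _ HAl (U_ge (S N)))) as [n [H1 H2]].
  destruct (Hu n) as [H3 H4].
  specialize (H1 H3).
  apply le_INR in H2; rewrite S_INR in H2.
  assert (Rabs (A (u n)) <= Rabs (A (u n) - A l) + Rabs (A l)).
  { replace (A (u n)) with ((A (u n) - A l) + A l) at 1 by ring; apply Rabs_triang. }
  lra.
Qed.

(** * Bounded variation tested on pairs of tags *)

Lemma partition_extend (A : R -> R) (a b c : R) (n : nat) (p : nat -> R) :
  is_partition a b n p -> b <= c ->
  exists n' p', is_partition a c n' p' /\
    fsum n' (fun i => Rabs (A (p' (S i)) - A (p' i))) =
    fsum n (fun i => Rabs (A (p (S i)) - A (p i))) + Rabs (A c - A b).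
Proof.
  intros [H0 [Hn Hp]] Hc.
  exists (S n), (fun i => if Nat.leb i n then p i else c); split; [split; [|split]|].
  - simpl; exact H0.
  - cbv beta; now rewrite (proj2 (Nat.leb_gt (S n) n)) by lia.
  - intros i Hi; cbv beta; rewrite (proj2 (Nat.leb_le i n)) by lia.
    destruct (Nat.leb_spec (S i) n) as [H|H]; [apply Hp; lia|].
    replace i with n by lia; lra.
  - cbn [fsum]; rewrite Nat.leb_refl, (proj2 (Nat.leb_gt (S n) n)) by lia.
    rewrite Hn; f_equal.
    apply fsum_ext; intros i Hi.
    rewrite (proj2 (Nat.leb_le i n)) by lia.
    case_eq (Nat.leb (S i) n); intro H; [reflexivity|].
    apply Nat.leb_gt in H; lia.
Qed.

(** Inserting the smaller and the larger tag into each interval gives a refined partition in which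
    every [|A (xi i) - A (eta i)|] is itself a term of the variation sum. *)
Lemma tags_variation (A : R -> R) (n : nat) (p xi eta : nat -> R) :
  (forall i, (i < n)%nat -> p i <= p (S i)) ->
  is_tagging n p xi -> is_tagging n p eta ->
  exists n' p', is_partition (p O) (p n) n' p' /\
    fsum n (fun i => Rabs (A (xi i) - A (eta i))) <=
    fsum n' (fun i => Rabs (A (p' (S i)) - A (p' i))).
Proof.
  induction n as [|n IH]; intros Hp Hxi Heta.
  - exists O, p; split; [repeat split; intros; lia | simpl; lra].
  - destruct IH as [m [q [Hq Hle]]]; try (intros i Hi; auto with arith).
    specialize (Hxi n (Nat.lt_succ_diag_r n)); specialize (Heta n (Nat.lt_succ_diag_r n)).
    destruct (partition_extend A _ _ (Rmin (xi n) (eta n)) _ _ Hq) as [m1 [q1 [Hq1 E1]]];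
      [apply Rmin_glb; lra|].
    destruct (partition_extend A _ _ (Rmax (xi n) (eta n)) _ _ Hq1) as [m2 [q2 [Hq2 E2]]];
      [apply Rle_trans with (xi n); [apply Rmin_l | apply Rmax_l]|].
    destruct (partition_extend A _ _ (p (S n)) _ _ Hq2) as [m3 [q3 [Hq3 E3]]];
      [apply Rmax_lub; lra|].
    exists m3, q3; split; [exact Hq3|].
    rewrite E3, E2, E1; simpl.
    assert (Rabs (A (xi n) - A (eta n)) =
            Rabs (A (Rmax (xi n) (eta n)) - A (Rmin (xi n) (eta n)))).
    { destruct (Rle_dec (xi n) (eta n)) as [H|H].
      - rewrite Rmin_left, Rmax_right by lra; apply Rabs_minus_sym.
      - rewrite Rmin_right, Rmax_left by lra; reflexivity. }
    generalize (Rabs_pos (A (p (S n)) - A (Rmax (xi n) (eta n))))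
      (Rabs_pos (A (Rmin (xi n) (eta n)) - A (p n))); lra.
Qed.

Lemma BV_bounded (A : R -> R) (a b : R) : BV_on A a b -> bounded_on A a b.
Proof.
  intros [M HM]; exists (Rabs (A a) + M); intros t Ht.
  (* Starting from the trivial partition of [[a, a]], two extensions produce the partition
     [a, t, b]. *)
  assert (H0 : is_partition a a 0 (fun _ => a)) by (repeat split; intros; lia).
  destruct (partition_extend A _ _ t _ _ H0) as [n1 [p1 [H1 E1]]]; [lra|].
  destruct (partition_extend A _ _ b _ _ H1) as [n2 [p2 [H2 E2]]]; [lra|].
  specialize (HM _ _ H2); rewrite E2, E1 in HM; simpl in HM.
  assert (Rabs (A t) <= Rabs (A t - A a) + Rabs (A a)).
  { replace (A t) with ((A t - A a) + A a) at 1 by ring; apply Rabs_triang. }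
  generalize (Rabs_pos (A b - A t)); lra.
Qed.

Lemma BV_tags_sum (A : R -> R) (a b : R) :
  BV_on A a b -> exists M, 0 <= M /\
    forall n p xi eta, is_partition a b n p -> is_tagging n p xi -> is_tagging n p eta ->
      fsum n (fun i => Rabs (A (xi i) - A (eta i))) <= M.
Proof.
  (* If [b < a] there are no partitions at all and [M] may be negative, hence the maximum with 0. *)
  intros [M HM]; exists (Rmax 0 M); split; [apply Rmax_l|].
  intros n p xi eta [H0 [Hn Hp]] Hxi Heta.
  destruct (tags_variation A n p xi eta Hp Hxi Heta) as [n' [p' [Hp' Hle]]].
  rewrite H0, Hn in Hp'; specialize (HM _ _ Hp').
  apply Rle_trans with M; [lra | apply Rmax_r].
Qed.

Lemma BV_osc_small (A : R -> R) : BV_on A 0 1 -> osc_small A.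
Proof.
  intros HA e He; destruct (BV_tags_sum A 0 1 HA) as [M [HM HS]].
  assert (Hd : 0 < e / (M + 1)) by (apply Rdiv_lt_0_compat; lra).
  exists (e / (M + 1)); split; [exact Hd|].
  intros n p xi eta Hp Hxi Heta Hm.
  apply Rle_lt_trans with (e / (M + 1) * M).
  - apply Rle_trans with (e / (M + 1) * fsum n (fun i => Rabs (A (xi i) - A (eta i)))).
    + rewrite <- fsum_scal; apply fsum_le; intros i Hi.
      rewrite Rmult_comm; apply Rmult_le_compat_r; [apply Rabs_pos | left; apply Hm; exact Hi].
    + apply Rmult_le_compat_l; [lra | apply (HS n p); assumption].
  - apply Rlt_le_trans with (e / (M + 1) * (M + 1)).
    + apply Rmult_lt_compat_l; lra.
    + right; field; lra.
Qed.

(** An interval left of [a] contributes at most [e / 4] times its length, those right of [a] at most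
    the mesh times the variation on [[a, 1]], and one straddling [a] at most [2 K] times its length.
    Each term is dominated by one of the nonnegative [F1 i], [F2 i], [F3 i], so all three can be
    summed over all [i]; each sum is at most [e / 4]. *)
Lemma Omega01_osc_small (A : R -> R) : Omega01 A -> osc_small A.
Proof.
  intros [[K HK] HO] e He.
  destruct (HO (e / 4)) as [a [Ha [[_ [d1 [Hd1 Hosc]]] HBV]]]; [lra|].
  destruct (BV_tags_sum A a 1 HBV) as [M [HM HS]].
  assert (HK0 : 0 <= K) by (eapply Rle_trans; [apply Rabs_pos | apply (HK 0); lra]).
  set (d2 := e / 4 / (M + 1)); set (d3 := e / 4 / (4 * K + 1)).
  assert (Hd2 : 0 < d2) by (apply Rdiv_lt_0_compat; lra).
  assert (Hd3 : 0 < d3) by (apply Rdiv_lt_0_compat; lra).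
  assert (E2 : d2 * M <= e / 4).
  { apply Rle_trans with (d2 * (M + 1)); [apply Rmult_le_compat_l; lra|].
    right; unfold d2; field; lra. }
  assert (E3 : 4 * K * d3 <= e / 4).
  { apply Rle_trans with (d3 * (4 * K + 1)); [lra|].
    right; unfold d3; field; lra. }
  set (d := Rmin d1 (Rmin d2 d3)).
  assert (Hd : 0 < d /\ d <= d1 /\ d <= d2 /\ d <= d3).
  { unfold d, Rmin; repeat destruct Rle_dec; lra. }
  destruct Hd as [Hd [Hdd1 [Hdd2 Hdd3]]].
  exists d; split; [exact Hd|]; intros n p xi eta Hp Hxi Heta Hm.
  (* Projection onto [[a - d, a + d]]. A straddling interval is shorter than [d] and so is fixed by
     it; the increments of [cl] telescope to at most [2 d], without singling out that interval. *)
  set (cl x := Rmax (a - d) (Rmin x (a + d))).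
  assert (Hcl : forall x y, x <= y -> cl x <= cl y).
  { intros x y Hxy; unfold cl, Rmax, Rmin; repeat destruct Rle_dec; lra. }
  assert (Hmx : forall x y, x <= y -> Rmax x a <= Rmax y a).
  { intros x y Hxy; unfold Rmax; repeat destruct Rle_dec; lra. }
  set (F1 i := e / 4 * (p (S i) - p i)).
  (* Taking the maximum with [a] turns the partition and its tags into tagged partitions of
     [[a, 1]], with degenerate intervals to the left of [a]. *)
  set (F2 i := d * Rabs (A (Rmax (xi i) a) - A (Rmax (eta i) a))).
  set (F3 i := 2 * K * (cl (p (S i)) - cl (p i))).
  apply Rle_lt_trans with (fsum n (fun i => F1 i + F2 i + F3 i)).
  - apply fsum_le; intros i Hi.
    assert (H1 := partition_range _ _ _ _ i Hp ltac:(lia)).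
    assert (H2 := partition_range _ _ _ _ (S i) Hp ltac:(lia)).
    specialize (Hxi i Hi); specialize (Heta i Hi); specialize (Hm i Hi).
    assert (P1 : 0 <= F1 i) by (unfold F1; apply Rmult_le_pos; lra).
    assert (P2 : 0 <= F2 i) by (unfold F2; apply Rmult_le_pos; [lra | apply Rabs_pos]).
    assert (P3 : 0 <= F3 i).
    { unfold F3; apply Rmult_le_pos; [lra|]; generalize (Hcl (p i) (p (S i))); lra. }
    destruct (Rle_dec (p (S i)) a) as [C1|C1].
    { apply Rle_trans with (F1 i); [|lra].
      unfold F1; apply Rmult_le_compat_r; [lra|].
      destruct (Rle_dec (xi i) (eta i)).
      - rewrite Rabs_minus_sym; apply (Hosc (p i) (p (S i))); lra.
      - apply (Hosc (p i) (p (S i))); lra. }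
    destruct (Rle_dec a (p i)) as [C2|C2].
    { apply Rle_trans with (F2 i); [|lra].
      unfold F2; rewrite !Rmax_left by lra; rewrite Rmult_comm.
      apply Rmult_le_compat_r; [apply Rabs_pos | lra]. }
    apply Rle_trans with (F3 i); [|lra]; unfold F3.
    replace (cl (p (S i))) with (p (S i))
      by (unfold cl, Rmax, Rmin; repeat destruct Rle_dec; lra).
    replace (cl (p i)) with (p i)
      by (unfold cl, Rmax, Rmin; repeat destruct Rle_dec; lra).
    apply Rmult_le_compat_r; [lra|].
    unfold Rminus; eapply Rle_trans; [apply Rabs_triang|]; rewrite Rabs_Ropp.
    generalize (HK (xi i) ltac:(lra)) (HK (eta i) ltac:(lra)); lra.
  - rewrite !fsum_plus.
    assert (S1 : fsum n F1 = e / 4).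
    { unfold F1; rewrite fsum_scal, fsum_telescope; destruct Hp as [-> [-> _]]; lra. }
    assert (S2 : fsum n F2 <= d * M).
    { unfold F2; rewrite fsum_scal; apply Rmult_le_compat_l; [lra|].
      apply (HS n (fun i => Rmax (p i) a) (fun i => Rmax (xi i) a) (fun i => Rmax (eta i) a)).
      - destruct Hp as [p0 [pn Hp]]; split; [|split].
        + rewrite p0; apply Rmax_right; lra.
        + rewrite pn; apply Rmax_left; lra.
        + intros i Hi; auto.
      - intros i Hi; specialize (Hxi i Hi); split; apply Hmx; lra.
      - intros i Hi; specialize (Heta i Hi); split; apply Hmx; lra. }
    assert (S3 : fsum n F3 <= 2 * K * (2 * d)).
    { unfold F3; rewrite fsum_scal, (fsum_telescope n (fun i => cl (p i))).
      apply Rmult_le_compat_l; [lra|].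
      unfold cl, Rmax, Rmin; repeat destruct Rle_dec; lra. }
    assert (d * M <= d2 * M) by (apply Rmult_le_compat_r; lra).
    assert (4 * K * d <= 4 * K * d3) by (apply Rmult_le_compat_l; lra).
    lra.
Qed.

Lemma OmegaHat01_osc_small (A : R -> R) : OmegaHat01 A -> osc_small A.
Proof.
  intros [H|[H|H]].
  - apply Omega01_osc_small; exact H.
  - apply unif_cont_osc_small, C01_unif_cont; exact H.
  - apply BV_osc_small; exact H.
Qed.

Lemma OmegaHat01_bounded (A : R -> R) : OmegaHat01 A -> bounded_on A 0 1.
Proof.
  intros [H|[H|H]].
  - apply H.
  - apply C01_bounded; exact H.
  - apply BV_bounded; exact H.
Qed.

(* The increment of x - and likewise that of the limit of the partial means of
   A * Y - over [s, t] only sees the grid points in [s, t], so the error on each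
   interval of a partition is at most Q times the oscillation of A times its length. *)
Lemma RS_integral_ulim (A : R -> R) (Y : nat -> nat -> R) (P : nat -> R) (x : R -> R) (Q I : R) :
  osc_small A -> bounded_on A 0 1 ->
  (forall n k, (k < n)%nat -> Rabs (Y n k) <= Q) ->
  (forall t, 0 <= t <= 1 -> is_ulim (fun n => P n + partial_mean n (Y n) t) (x t)) ->
  is_ulim (fun n => mean n (fun k => A (INR k / INR n) * Y n k)) I ->
  is_RS_integral A x 0 1 I.
Proof.
  intros HA [K HK] HY Hx HI e He.
  assert (HQ0 : 0 <= Q) by (eapply Rle_trans; [apply Rabs_pos | apply (HY 1%nat 0%nat); lia]).
  set (G n k := A (INR k / INR n) * Y n k).
  assert (HG : forall n k, (k < n)%nat -> Rabs (G n k) <= K * Q).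
  { intros n k Hk; unfold G; rewrite Rabs_mult.
    apply Rmult_le_compat; try apply Rabs_pos; [apply HK, grid_in_01; lia | auto]. }
  assert (Hex : forall t, exists l, 0 <= t <= 1 -> is_ulim (fun n => partial_mean n (G n) t) l).
  { intro t; destruct (classic (0 <= t <= 1)) as [Ht|Ht].
    - destruct (partial_mean_ulim_exists G (K * Q) t Ht HG) as [l Hl]; exists l; auto.
    - exists 0; contradiction. }
  (* [F t] stands for the integral of [A] against [x] from 0 to [t]: each term of a
     Riemann-Stieltjes sum is compared with an increment of [F], and these increments telescope to
     [I]. *)
  destruct (choice _ Hex) as [F HF].
  assert (F0 : F 0 = 0).
  { apply (is_ulim_unique _ _ _ (HF 0 ltac:(lra))).
    apply (is_ulim_ext (fun _ => 0)); [|apply is_ulim_const].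
    apply filter_forall; intro n; now rewrite partial_mean_0. }
  assert (F1 : F 1 = I).
  { apply (is_ulim_unique _ _ _ (HF 1 ltac:(lra))).
    apply (is_ulim_ext (fun n => mean n (G n))); [|exact HI].
    apply filter_forall; intro n; now rewrite partial_mean_1. }
  assert (Hinc : forall s t xi D, 0 <= s <= t -> t <= 1 ->
    (forall eta, s <= eta <= t -> Rabs (A xi - A eta) <= D) ->
    Rabs (A xi * (x t - x s) - (F t - F s)) <= (t - s) * (D * Q)).
  { intros s t xi D Hst Ht HD.
    set (W n k := A xi * Y n k - G n k).
    assert (HW : forall r, 0 <= r <= 1 ->
      is_ulim (fun n => A xi * P n + partial_mean n (W n) r) (A xi * x r - F r)).
    { intros r Hr.
      apply (is_ulim_ext (fun n => A xi * (P n + partial_mean n (Y n) r) - partial_mean n (G n) r)).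
      - apply filter_forall; intro n; unfold partial_mean, W.
        rewrite fsum_minus, fsum_scal; ring.
      - apply is_ulim_minus; [apply is_ulim_scal; auto | auto]. }
    replace (A xi * (x t - x s) - (F t - F s))
      with (A xi * x t - F t - (A xi * x s - F s) - 0 * (t - s)) by ring.
    apply (partial_mean_increment W (fun n => A xi * P n)); try (apply HW; lra); [lra|].
    apply filter_forall; intros n k Hk Hkn.
    assert (Hkn' : (k < n)%nat) by (assert (H := ceil_index_le_n n t ltac:(lra)); lia).
    replace (W n k - 0) with ((A xi - A (INR k / INR n)) * Y n k) by (unfold W, G; ring).
    rewrite Rabs_mult; apply Rmult_le_compat; try apply Rabs_pos; auto. }
  (* This amount is spent twice, on the oscillation sum and on the defect of the tags [eta]; after
     multiplication by [Q] each costs at most [e / 4]. *)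
  destruct (HA (e / (4 * (Q + 1)))) as [d [Hd Hosc]]; [apply Rdiv_lt_0_compat; lra|].
  exists d; split; [exact Hd|]; intros n p xi Hp Hxi Hm.
  (* a tag eta nearly realising the oscillation seen from xi *)
  assert (Heta : forall i, exists eta, (i < n)%nat -> p i <= eta <= p (S i) /\
    Rabs (A (xi i) * (x (p (S i)) - x (p i)) - (F (p (S i)) - F (p i))) <=
    (p (S i) - p i) * ((Rabs (A (xi i) - A eta) + e / (4 * (Q + 1))) * Q)).
  { intro i; destruct (classic (i < n)%nat) as [Hi|Hi]; [|exists 0; contradiction].
    assert (H1 := partition_range _ _ _ _ i Hp ltac:(lia)).
    assert (H2 := partition_range _ _ _ _ (S i) Hp ltac:(lia)).
    assert (H3 : p i <= p (S i)) by (apply Hp; exact Hi).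
    assert (He' : 0 < e / (4 * (Q + 1))) by (apply Rdiv_lt_0_compat; lra).
    (* The supremum [D] of [|A (xi i) - A eta|] need not be attained, while [osc_small] speaks of
       tags only; hence a tag that comes within the second share of it. *)
    destruct (completeness (fun r => exists eta, p i <= eta <= p (S i) /\ r = Rabs (A (xi i) - A eta)))
      as [D [HD1 HD2]].
    - exists (Rabs (A (xi i)) + K); intros r [eta [Heta ->]].
      unfold Rminus; eapply Rle_trans; [apply Rabs_triang|]; rewrite Rabs_Ropp.
      generalize (HK eta ltac:(lra)); lra.
    - exists (Rabs (A (xi i) - A (p i))), (p i); split; [lra | reflexivity].
    - assert (Hn : exists eta, p i <= eta <= p (S i) /\
                     D - e / (4 * (Q + 1)) < Rabs (A (xi i) - A eta)).
      { apply NNPP; intro Hn.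
        assert (D <= D - e / (4 * (Q + 1))); [|lra].
        apply HD2; intros r [eta [Heta ->]]; apply Rnot_lt_le; intro Hlt.
        apply Hn; exists eta; auto. }
      destruct Hn as [eta [Heta Hlt]]; exists eta; intros _; split; [exact Heta|].
      eapply Rle_trans; [apply (Hinc _ _ _ D); try lra|].
      + intros eta' Heta'; apply HD1; exists eta'; auto.
      + apply Rmult_le_compat_l; [lra|]; apply Rmult_le_compat_r; lra. }
  destruct (choice _ Heta) as [eta Heta'].
  assert (Hsum : fsum n (fun i => F (p (S i)) - F (p i)) = I).
  { rewrite (fsum_telescope n (fun i => F (p i))).
    destruct Hp as [-> [-> _]]; rewrite F0, F1; ring. }
  unfold RS_sum; rewrite <- Hsum, <- fsum_minus.
  eapply Rle_lt_trans; [apply fsum_Rabs|].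
  apply Rle_lt_trans with (fsum n (fun i =>
     Q * (Rabs (A (xi i) - A (eta i)) * (p (S i) - p i)) +
     Q * (e / (4 * (Q + 1))) * (p (S i) - p i))).
  - apply fsum_le; intros i Hi; eapply Rle_trans; [apply (Heta' i Hi)|]; right; ring.
  - rewrite fsum_plus, !fsum_scal, fsum_telescope.
    assert (Ho := Hosc n p xi eta Hp Hxi (fun i Hi => proj1 (Heta' i Hi)) Hm).
    destruct Hp as [-> [-> _]].
    assert (Hq : Q * (e / (4 * (Q + 1))) <= e / 4).
    { apply Rle_trans with ((Q + 1) * (e / (4 * (Q + 1)))).
      - apply Rmult_le_compat_r; [left; apply Rdiv_lt_0_compat |]; lra.
      - right; field; lra. }
    apply Rlt_le in Ho; apply (Rmult_le_compat_l Q) in Ho; [|exact HQ0]; lra.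
Qed.

(** * Riemann sums as Riemann-Stieltjes sums *)

Lemma fsum_S_l (n : nat) (F : nat -> R) :
  fsum (S n) F = F O + fsum n (fun i => F (S i)).
Proof.
  induction n as [|n IH]; [simpl; ring|].
  change (fsum (S (S n)) F) with (fsum (S n) F + F (S n)); rewrite IH; simpl; ring.
Qed.

Lemma Riemann_sum_fsum (D : R -> R) (ptd : SF_seq) :
  Riemann_sum D ptd =
  RS_sum D (fun t => t) (SF_size ptd) (seq.nth 0 (SF_lx ptd)) (seq.nth 0 (SF_ly ptd)).
Proof.
  induction ptd as [x|h s IH] using SF_cons_ind; [reflexivity|].
  rewrite Riemann_sum_cons, IH.
  change (SF_size (SF_cons h s)) with (S (SF_size s)).
  unfold RS_sum; rewrite fsum_S_l.
  unfold plus, scal; simpl; unfold mult, SF_lx, SF_ly; simpl; ring.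
Qed.

Lemma last_SF_lx (ptd : SF_seq (T := R)) (x : R) :
  seq.last x (SF_lx ptd) = seq.nth 0 (SF_lx ptd) (SF_size ptd).
Proof.
  revert x; induction ptd as [y|h s IH] using SF_cons_ind; intro x; [reflexivity|].
  change (seq.last (fst h) (SF_lx s) = seq.nth 0 (SF_lx s) (SF_size s)); apply IH.
Qed.

(** Links the assumption on [A - B], phrased with [RInt], to the Riemann-Stieltjes machinery; it
    also supplies existence, since [RInt] by itself is a total function. *)
Lemma RS_integral_id_RInt (D : R -> R) (I : R) :
  is_RS_integral D (fun t => t) 0 1 I -> is_RInt D 0 1 I.
Proof.
  intro H; apply filterlim_locally; intro eps.
  destruct (H eps (cond_pos eps)) as [d [Hd HS]].
  exists (mkposreal d Hd); intros ptd Hstep [Hptd [Hh Hl]].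
  rewrite Rmin_left in Hh by lra; rewrite Rmax_right, last_SF_lx in Hl by lra.
  change (Rabs (sign (1 - 0) * Riemann_sum D ptd - I) < eps).
  rewrite sign_eq_1, Rmult_1_l, Riemann_sum_fsum by lra.
  apply HS.
  - split; [exact Hh | split; [exact Hl |]].
    intros i Hi; specialize (Hptd i Hi); lra.
  - exact Hptd.
  - intros i Hi; eapply Rle_lt_trans; [apply Rle_abs|].
    eapply Rle_lt_trans; [|exact Hstep].
    apply nth_le_seq_step; rewrite SF_size_lx; lia.
Qed.

(** * The Poincare-Miranda theorem in the plane *)

Inductive label := lab0 | lab1 | lab2.

(* An antisymmetric 1-cochain that is a coboundary on any two labels, so that
   its sum around a square vanishes unless all three labels occur. *)
Definition label_cochain (a b : label) : R :=
  match a, b with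
  | lab0, lab1 => 1
  | lab1, lab0 => -1
  | _, _ => 0
  end.

Definition corner (L : nat -> nat -> label) (i j : nat) (c : label) : Prop :=
  exists di dj, (di <= 1)%nat /\ (dj <= 1)%nat /\ L (i + di)%nat (j + dj)%nat = c.

(** A discrete Stokes argument. Without a three-coloured square the cochain sums to 0 around every
    square, hence around the boundary of the grid. There the bottom, top and right sides contribute
    0, while the left side runs from [lab0] to [lab1] avoiding [lab2] and contributes a nonzero
    amount. *)
Lemma grid_rainbow_square (N : nat) (L : nat -> nat -> label) :
  (forall j, (j <= N)%nat -> L O j <> lab2) -> (forall j, (j <= N)%nat -> L N j = lab2) ->
  (forall i, (i <= N)%nat -> L i O <> lab1) -> (forall i, (i <= N)%nat -> L i N <> lab0) ->
  exists i j, (i < N)%nat /\ (j < N)%nat /\ forall c, corner L i j c.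
Proof.
  intros Hleft Hright Hbot Htop; apply NNPP; intro Hn.
  set (H i j := label_cochain (L i j) (L (S i) j)).
  set (V i j := label_cochain (L i j) (L i (S j))).
  assert (Hcell : forall i j, (i < N)%nat -> (j < N)%nat ->
    (V (S i) j - V i j) - (H i (S j) - H i j) = 0).
  { intros i j Hi Hj; apply NNPP; intro Hne; apply Hn; exists i, j.
    split; [exact Hi | split; [exact Hj|]].
    assert (C00 : corner L i j (L i j)) by (exists 0%nat, 0%nat; rewrite !Nat.add_0_r; auto).
    assert (C10 : corner L i j (L (S i) j))
      by (exists 1%nat, 0%nat; rewrite Nat.add_0_r, Nat.add_1_r; auto).
    assert (C01 : corner L i j (L i (S j)))
      by (exists 0%nat, 1%nat; rewrite Nat.add_0_r, Nat.add_1_r; auto).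
    assert (C11 : corner L i j (L (S i) (S j)))
      by (exists 1%nat, 1%nat; rewrite !Nat.add_1_r; auto).
    unfold V, H in Hne.
    destruct (L i j), (L (S i) j), (L i (S j)), (L (S i) (S j)); simpl in Hne;
      try (exfalso; apply Hne; ring); intros []; assumption. }
  assert (Hsum : fsum N (fun i => fsum N (fun j => (V (S i) j - V i j) - (H i (S j) - H i j))) = 0).
  { rewrite (fsum_ext N _ (fun _ => 0)), fsum_0; [reflexivity|]; intros i Hi.
    rewrite (fsum_ext N _ (fun _ => 0)), fsum_0; auto. }
  rewrite (fsum_ext N _ (fun i => fsum N (fun j => V (S i) j - V i j) - (H i N - H i O))),
    fsum_minus, fsum_exchange in Hsum
    by (intros i Hi; rewrite fsum_minus, (fsum_telescope N (H i)); reflexivity).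
  rewrite (fsum_ext N (fun j => fsum N _) (fun j => V N j - V O j)) in Hsum
    by (intros j Hj; rewrite (fsum_telescope N (fun i => V i j)); reflexivity).
  rewrite (fsum_ext N (fun i => H i N - H i O) (fun _ => 0)), fsum_0 in Hsum.
  2:{ intros i Hi; unfold H.
      assert (H1 := Hbot i ltac:(lia)); assert (H2 := Hbot (S i) ltac:(lia)).
      assert (H3 := Htop i ltac:(lia)); assert (H4 := Htop (S i) ltac:(lia)).
      destruct (L i N), (L (S i) N), (L i O), (L (S i) O); simpl; try congruence; ring. }
  (* On labels other than [lab2] the cochain is the coboundary of [h], so the left side
     telescopes. *)
  set (h a := match a with lab1 => 1 | _ => 0 end).
  rewrite (fsum_ext N _ (fun j => -1 * (h (L O (S j)) - h (L O j)))) in Hsum.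
  2:{ intros j Hj; unfold V.
      rewrite (Hright j), (Hright (S j)) by lia.
      assert (H1 := Hleft j ltac:(lia)); assert (H2 := Hleft (S j) ltac:(lia)).
      destruct (L O j), (L O (S j)); simpl; try congruence; ring. }
  rewrite fsum_scal, (fsum_telescope N (fun j => h (L O j))) in Hsum.
  assert (H1 := Hleft O ltac:(lia)); assert (H2 := Hbot O ltac:(lia)).
  assert (H3 := Hleft N ltac:(lia)); assert (H4 := Htop O ltac:(lia)).
  destruct (L O O), (L O N); simpl in Hsum; try congruence; lra.
Qed.

Lemma is_ulim_pair (g : R -> R -> R) (a b : nat -> R) (p q : R) :
  continuous (fun z : R * R => g (fst z) (snd z)) (p, q) ->
  is_ulim a p -> is_ulim b q -> is_ulim (fun n => g (a n) (b n)) (g p q).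
Proof.
  intros Hg Ha Hb.
  apply (filterlim_comp _ _ _ (fun n => (a n, b n)) (fun z => g (fst z) (snd z)) U (locally (p, q)));
    [|exact Hg].
  apply filterlim_locally; intro e.
  exact (U_and _ _ (proj1 (filterlim_locally _ _) Ha e) (proj1 (filterlim_locally _ _) Hb e)).
Qed.

(** Label a point by [lab2] if [u < 0], else by [lab1] if [v < 0], else by [lab0]; the boundary
    signs are then those of [grid_rainbow_square]. Squares with all three labels shrink to a point
    [(p, q)], where [lab0] leaves [u, v >= 0], [lab1] leaves [v <= 0] and [lab2] leaves [u <= 0]. *)
Lemma poincare_miranda (u v : R -> R -> R) (a b : R) :
  0 < a -> 0 < b ->
  (forall z, continuous (fun z : R * R => u (fst z) (snd z)) z) ->
  (forall z, continuous (fun z : R * R => v (fst z) (snd z)) z) ->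
  (forall q, -b <= q <= b -> 0 < u (-a) q) -> (forall q, -b <= q <= b -> u a q < 0) ->
  (forall p, -a <= p <= a -> 0 < v p (-b)) -> (forall p, -a <= p <= a -> v p b < 0) ->
  exists p q, -a <= p <= a /\ -b <= q <= b /\ u p q = 0 /\ v p q = 0.
Proof.
  intros Ha Hb Hu Hv Hleft Hright Hbot Htop.
  set (gr (c : R) (n i : nat) := - c + 2 * c * (INR i / INR (S n))).
  assert (HS : forall n, 0 < INR (S n)) by (intro; apply lt_0_INR; lia).
  assert (Hgr0 : forall c n, gr c n O = - c) by (intros; unfold gr; simpl; field; apply Rgt_not_eq, HS).
  assert (HgrN : forall c n, gr c n (S n) = c) by (intros; unfold gr; field; apply Rgt_not_eq, HS).
  assert (Hgr : forall c n i, 0 < c -> (i <= S n)%nat -> - c <= gr c n i <= c).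
  { intros c n i Hc Hi; unfold gr.
    generalize (grid_in_01 (S n) i Hi); nra. }
  set (lab (x y : R) := if Rlt_dec x 0 then lab2 else if Rlt_dec y 0 then lab1 else lab0).
  assert (Hcells : forall n, exists ij : nat * nat, (fst ij < S n)%nat /\ (snd ij < S n)%nat /\
    forall c, corner (fun i j => lab (u (gr a n i) (gr b n j)) (v (gr a n i) (gr b n j))) (fst ij) (snd ij) c).
  { intro n.
    destruct (grid_rainbow_square (S n)
      (fun i j => lab (u (gr a n i) (gr b n j)) (v (gr a n i) (gr b n j)))) as [i [j Hij]].
    - intros j Hj; unfold lab; rewrite Hgr0.
      generalize (Hleft (gr b n j) (Hgr b n j Hb Hj)); repeat destruct Rlt_dec; try discriminate; lra.
    - intros j Hj; unfold lab; rewrite HgrN.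
      generalize (Hright (gr b n j) (Hgr b n j Hb Hj)); repeat destruct Rlt_dec; try lra; reflexivity.
    - intros i Hi; unfold lab; rewrite Hgr0.
      generalize (Hbot (gr a n i) (Hgr a n i Ha Hi)); repeat destruct Rlt_dec; try discriminate; lra.
    - intros i Hi; unfold lab; rewrite HgrN.
      generalize (Htop (gr a n i) (Hgr a n i Ha Hi)); repeat destruct Rlt_dec; try discriminate; lra.
    - exists (i, j); exact Hij. }
  destruct (choice _ Hcells) as [ij Hij]; clear Hcells.
  destruct (is_ulim_bounded (fun n => gr a n (fst (ij n))) (-a) a) as [p [Hp Hlp]].
  { apply filter_forall; intro n; apply Hgr; [exact Ha | destruct (Hij n); lia]. }
  destruct (is_ulim_bounded (fun n => gr b n (snd (ij n))) (-b) b) as [q [Hq Hlq]].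
  { apply filter_forall; intro n; apply Hgr; [exact Hb | destruct (Hij n) as [_ [? _]]; lia]. }
  (* Corners of a square differ by at most [2 c / (n + 1)] in each coordinate, so whichever corner
     carries a given label, its limit is [(p, q)]. *)
  assert (Hshift : forall c l (k d : nat -> nat), 0 < c -> (forall n, (d n <= 1)%nat) ->
    is_ulim (fun n => gr c n (k n)) l -> is_ulim (fun n => gr c n (k n + d n)%nat) l).
  { intros c l k d Hc Hd Hl; apply is_ulim_eps; intros e He.
    generalize (U_and _ _ (proj1 (is_ulim_eps _ _) Hl (e / 2) ltac:(lra))
      (U_and _ _ U_INR_pos (U_inv_INR_lt (e / (4 * c)) ltac:(apply Rdiv_lt_0_compat; lra)))).
    apply filter_imp; intros n [H1 [H2 H3]].
    assert (H4 : gr c n (k n + d n)%nat - gr c n (k n) = 2 * c * (INR (d n) * / INR (S n))).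
    { unfold gr; rewrite plus_INR; field; apply Rgt_not_eq, HS. }
    assert (H5 : / INR (S n) <= / INR n) by (apply Rinv_le_contravar; [lra | rewrite S_INR; lra]).
    assert (H6 : 0 < / INR (S n)) by (apply Rinv_0_lt_compat, HS).
    assert (H7 : 0 <= INR (d n) <= 1).
    { split; [apply pos_INR | apply (le_INR _ 1), Hd]. }
    assert (H8 : 0 <= INR (d n) * / INR (S n) <= e / (4 * c)) by nra.
    assert (H9 : 2 * c * (e / (4 * c)) = e / 2) by (field; lra).
    assert (0 <= 2 * c * (INR (d n) * / INR (S n)) <= e / 2) by nra.
    apply Rabs_def2 in H1; apply Rabs_def1; lra. }
  assert (Hcol : forall c, exists x y : nat -> R, is_ulim x p /\ is_ulim y q /\
    forall n, lab (u (x n) (y n)) (v (x n) (y n)) = c).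
  { intro c.
    assert (Hc : forall n, exists d : nat * nat, (fst d <= 1)%nat /\ (snd d <= 1)%nat /\
      lab (u (gr a n (fst (ij n) + fst d)%nat) (gr b n (snd (ij n) + snd d)%nat))
          (v (gr a n (fst (ij n) + fst d)%nat) (gr b n (snd (ij n) + snd d)%nat)) = c).
    { intro n; destruct (Hij n) as [_ [_ H]]; destruct (H c) as [di [dj Hd]]; exists (di, dj); exact Hd. }
    destruct (choice _ Hc) as [d Hd].
    exists (fun n => gr a n (fst (ij n) + fst (d n))%nat), (fun n => gr b n (snd (ij n) + snd (d n))%nat).
    split; [|split; [|intro n; apply Hd]].
    - apply Hshift; [exact Ha | intro n; apply Hd | exact Hlp].
    - apply Hshift; [exact Hb | intro n; apply Hd | exact Hlq]. }
  exists p, q; split; [exact Hp | split; [exact Hq|]].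
  destruct (Hcol lab0) as [x0 [y0 [Hx0 [Hy0 H0]]]].
  destruct (Hcol lab1) as [x1 [y1 [Hx1 [Hy1 H1]]]].
  destruct (Hcol lab2) as [x2 [y2 [Hx2 [Hy2 H2]]]].
  assert (Hlab : forall s t c, lab s t = c ->
    match c with lab0 => 0 <= s /\ 0 <= t | lab1 => t <= 0 | lab2 => s <= 0 end).
  { intros s t c <-; unfold lab; repeat destruct Rlt_dec; lra. }
  split; apply Rle_antisym.
  - apply (is_ulim_le_const _ _ 0 (filter_forall _ (fun n => Hlab _ _ _ (H2 n))) (is_ulim_pair u x2 y2 p q (Hu _) Hx2 Hy2)).
  - apply (is_ulim_ge_const _ _ 0 (filter_forall _ (fun n => proj1 (Hlab _ _ _ (H0 n)))) (is_ulim_pair u x0 y0 p q (Hu _) Hx0 Hy0)).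
  - apply (is_ulim_le_const _ _ 0 (filter_forall _ (fun n => Hlab _ _ _ (H1 n))) (is_ulim_pair v x1 y1 p q (Hv _) Hx1 Hy1)).
  - apply (is_ulim_ge_const _ _ 0 (filter_forall _ (fun n => proj2 (Hlab _ _ _ (H0 n)))) (is_ulim_pair v x0 y0 p q (Hv _) Hx0 Hy0)).
Qed.

(** * Euler's scheme *)

Lemma cont_strip_eps (f : R -> R -> R) (t y eps : R) :
  cont_strip f -> 0 <= t <= 1 -> 0 < eps -> exists delta, 0 < delta /\
    forall t' y', 0 <= t' <= 1 -> Rabs (t' - t) < delta -> Rabs (y' - y) < delta ->
      Rabs (f t' y' - f t y) < eps.
Proof.
  intros Hf Ht He.
  destruct (proj1 (filterlim_locally _ _) (Hf t y Ht) (mkposreal eps He)) as [d Hd].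
  exists d; split; [apply cond_pos|]; intros t' y' Ht' H1 H2.
  exact (Hd (t', y') (conj H1 H2) Ht').
Qed.

Lemma cont_strip_bounded (f : R -> R -> R) (X : R) :
  cont_strip f -> exists M, 0 <= M /\
    forall t y, 0 <= t <= 1 -> Rabs y <= X -> Rabs (f t y) <= M.
Proof.
  intro Hf; apply NNPP; intro Hn.
  assert (Hbad : forall n : nat, exists z : R * R,
    0 <= fst z <= 1 /\ Rabs (snd z) <= X /\ INR n < Rabs (f (fst z) (snd z))).
  { intro n; apply NNPP; intro H; apply Hn; exists (INR n); split; [apply pos_INR|].
    intros t y Ht Hy; apply Rnot_lt_le; intro Hlt; apply H; exists (t, y); auto. }
  destruct (choice _ Hbad) as [z Hz].
  destruct (is_ulim_bounded (fun n => fst (z n)) 0 1) as [t [Ht Hlt]].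
  { apply filter_forall; intro n; apply Hz. }
  destruct (is_ulim_bounded (fun n => snd (z n)) (-X) X) as [y [Hy Hly]].
  { apply filter_forall; intro n; apply Rabs_le_between, Hz. }
  destruct (cont_strip_eps f t y 1 Hf Ht Rlt_0_1) as [d [Hd H]].
  destruct (nfloor_ex (Rabs (f t y) + 1)) as [N HN]; [generalize (Rabs_pos (f t y)); lra|].
  destruct (filter_ex _ (U_and _ _ (U_ge (S N)) (U_and _ _
    (proj1 (is_ulim_eps _ _) Hlt d Hd) (proj1 (is_ulim_eps _ _) Hly d Hd)))) as [n [H1 [H2 H3]]].
  destruct (Hz n) as [H4 [_ H5]].
  specialize (H _ _ H4 H2 H3).
  apply le_INR in H1; rewrite S_INR in H1.
  assert (Rabs (f (fst (z n)) (snd (z n))) <=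
    Rabs (f (fst (z n)) (snd (z n)) - f t y) + Rabs (f t y)).
  { replace (f (fst (z n)) (snd (z n))) with ((f (fst (z n)) (snd (z n)) - f t y) + f t y) at 1
      by ring; apply Rabs_triang. }
  lra.
Qed.

(** The explicit scheme for the system [x' = y], [y' = - lam f(t, x)] with initial values [p], [q].
    Both components are updated from the old pair, so [x] and [y] are exactly [p] and [q] plus
    left-endpoint sums. *)
Fixpoint euler (f : R -> R -> R) (lam : R) (n : nat) (p q : R) (k : nat) : R * R :=
  match k with
  | O => (p, q)
  | S j => let z := euler f lam n p q j in
      (fst z + / INR n * snd z, snd z + / INR n * (- lam * f (INR j / INR n) (fst z)))
  end.

Definition euler_x f lam n p q k := fst (euler f lam n p q k).
Definition euler_y f lam n p q k := snd (euler f lam n p q k).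
Definition euler_g f lam n p q k := - lam * f (INR k / INR n) (euler_x f lam n p q k).

Lemma euler_x_sum (f : R -> R -> R) (lam : R) (n : nat) (p q : R) (k : nat) :
  euler_x f lam n p q k = p + / INR n * fsum k (euler_y f lam n p q).
Proof.
  induction k as [|k IH]; unfold euler_x in *; simpl; [ring|].
  rewrite IH; unfold euler_y at 3; ring.
Qed.

Lemma euler_y_sum (f : R -> R -> R) (lam : R) (n : nat) (p q : R) (k : nat) :
  euler_y f lam n p q k = q + / INR n * fsum k (euler_g f lam n p q).
Proof.
  induction k as [|k IH]; unfold euler_y in *; simpl; [ring|].
  rewrite IH; unfold euler_g at 3, euler_x; ring.
Qed.

Lemma euler_continuous (f : R -> R -> R) (lam : R) (n k : nat) (z : R * R) :
  cont_strip f -> (k <= n)%nat ->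
  continuous (fun z => euler_x f lam n (fst z) (snd z) k) z /\
  continuous (fun z => euler_y f lam n (fst z) (snd z) k) z.
Proof.
  intro Hf; induction k as [|k IH]; intro Hk.
  - split; [apply continuous_fst | apply continuous_snd].
  - destruct IH as [IHx IHy]; [lia|].
    assert (Hfk : continuous (f (INR k / INR n)) (euler_x f lam n (fst z) (snd z) k)).
    { apply filterlim_locally; intro e.
      assert (Hk01 := grid_in_01 n k (Nat.lt_le_incl _ _ Hk)).
      destruct (cont_strip_eps f _ (euler_x f lam n (fst z) (snd z) k) e Hf Hk01 (cond_pos e)) as [d [Hd H]].
      exists (mkposreal d Hd); intros y Hy.
      apply H; [exact Hk01 | rewrite Rminus_diag, Rabs_R0; exact Hd | exact Hy]. }
    split.
    + apply (continuous_plus (V := R_NormedModule) (fun z => euler_x f lam n (fst z) (snd z) k)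
        (fun z => / INR n * euler_y f lam n (fst z) (snd z) k)); [exact IHx|].
      apply (continuous_scal_r (V := R_NormedModule)); exact IHy.
    + apply (continuous_plus (V := R_NormedModule) (fun z => euler_y f lam n (fst z) (snd z) k)
        (fun z => / INR n * (- lam * f (INR k / INR n) (euler_x f lam n (fst z) (snd z) k)))); [exact IHy|].
      apply (continuous_scal_r (V := R_NormedModule)), (continuous_scal_r (V := R_NormedModule)).
      apply (continuous_comp (fun z => euler_x f lam n (fst z) (snd z) k) (f (INR k / INR n)));
        [exact IHx | exact Hfk].
Qed.

Lemma mean_continuous (n : nat) (F : nat -> R * R -> R) (z : R * R) :
  (forall k, (k < n)%nat -> continuous (F k) z) ->
  continuous (fun z => mean n (fun k => F k z)) z.
Proof.
  intro H; apply (continuous_scal_r (V := R_NormedModule) (/ INR n)).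
  assert (Hm : forall m, (m <= n)%nat -> continuous (fun z => fsum m (fun k => F k z)) z).
  { induction m as [|m IH]; intro Hm; [apply continuous_const|].
    apply (continuous_plus (V := R_NormedModule) (fun z => fsum m (fun k => F k z)) (F m));
      [apply IH; lia | apply H; lia]. }
  apply Hm; lia.
Qed.

(** [M] bounds [f] only where [|y| <= P + 2], so both estimates go through one induction: the bound
    on [x] keeps the next slope under control, and the slope, of modulus at most 2, advances the
    bound on [x]. Growth in [k / n] lets the step close and still ends below [P + 2]. *)
Lemma euler_bounds (f : R -> R -> R) (lam M P : R) (n : nat) (p q : R) (k : nat) :
  (forall t y, 0 <= t <= 1 -> Rabs y <= P + 2 -> Rabs (f t y) <= M) ->
  Rabs lam * M <= 1 -> Rabs p <= P -> Rabs q <= 1 -> (0 < n)%nat -> (k <= n)%nat ->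
  Rabs (euler_x f lam n p q k) <= P + 2 * (INR k / INR n) /\
  Rabs (euler_y f lam n p q k - q) <= Rabs lam * M * (INR k / INR n).
Proof.
  intros HM Hlam Hp Hq Hn; assert (Hn' : 0 < INR n) by (apply lt_0_INR; lia).
  assert (Hi : 0 < / INR n) by (apply Rinv_0_lt_compat; exact Hn').
  induction k as [|k IH]; intro Hk.
  - unfold euler_x, euler_y; simpl; unfold Rdiv; rewrite Rminus_diag, Rabs_R0; lra.
  - destruct IH as [IHx IHy]; [lia|].
    assert (Hk01 := grid_in_01 n k (Nat.lt_le_incl _ _ Hk)).
    assert (HM0 : 0 <= M).
    { eapply Rle_trans; [apply Rabs_pos | apply (HM 0 0); [lra|]].
      rewrite Rabs_R0; generalize (Rabs_pos p); lra. }
    assert (HL : 0 <= Rabs lam * M) by (apply Rmult_le_pos; [apply Rabs_pos | exact HM0]).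
    assert (ES : INR (S k) / INR n = INR k / INR n + / INR n) by (rewrite S_INR; field; lra).
    rewrite ES.
    change (euler_x f lam n p q (S k)) with
      (euler_x f lam n p q k + / INR n * euler_y f lam n p q k).
    change (euler_y f lam n p q (S k)) with
      (euler_y f lam n p q k + / INR n * euler_g f lam n p q k).
    set (X := euler_x f lam n p q k) in *; set (Y := euler_y f lam n p q k) in *.
    assert (HX : Rabs X <= P + 2) by lra.
    assert (HY : Rabs Y <= 2).
    { replace Y with ((Y - q) + q) by ring; eapply Rle_trans; [apply Rabs_triang|].
      assert (Rabs lam * M * (INR k / INR n) <= 1 * 1) by (apply Rmult_le_compat; lra); lra. }
    split.
    + eapply Rle_trans; [apply Rabs_triang|].
      rewrite Rabs_mult, (Rabs_pos_eq (/ INR n)) by lra.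
      assert (/ INR n * Rabs Y <= / INR n * 2) by (apply Rmult_le_compat_l; lra); lra.
    + replace (Y + / INR n * euler_g f lam n p q k - q)
        with ((Y - q) + / INR n * euler_g f lam n p q k) by ring.
      eapply Rle_trans; [apply Rabs_triang|].
      rewrite Rabs_mult, (Rabs_pos_eq (/ INR n)) by lra.
      assert (Rabs (euler_g f lam n p q k) <= Rabs lam * M).
      { unfold euler_g; rewrite Rabs_mult, Rabs_Ropp; apply Rmult_le_compat_l; [apply Rabs_pos|].
        apply HM; assumption. }
      assert (/ INR n * Rabs (euler_g f lam n p q k) <= / INR n * (Rabs lam * M))
        by (apply Rmult_le_compat_l; lra); lra.
Qed.

(** * The discrete boundary value problem *)

Lemma mean_plus (n : nat) (F G : nat -> R) :
  mean n (fun k => F k + G k) = mean n F + mean n G.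
Proof. unfold mean; rewrite fsum_plus; ring. Qed.

Lemma mean_scal (n : nat) (c : R) (F : nat -> R) :
  mean n (fun k => c * F k) = c * mean n F.
Proof. unfold mean; rewrite fsum_scal; ring. Qed.

Lemma mean_ext (n : nat) (F G : nat -> R) :
  (forall k, (k < n)%nat -> F k = G k) -> mean n F = mean n G.
Proof. intro H; unfold mean; rewrite (fsum_ext n F G H); reflexivity. Qed.

Lemma mean_const (n : nat) (c : R) : (0 < n)%nat -> mean n (fun _ => c) = c.
Proof.
  intro Hn; assert (0 < INR n) by (apply lt_0_INR; lia).
  unfold mean; rewrite fsum_const; field; lra.
Qed.

(** [u] is the defect of the first condition, [v] minus the combination of both. On [p = ±(2 K + 1)]
    the term [- p] beats [|mean (A y)| <= 2 K]; on [q = ±1] the term [- q * mean D], of modulus at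
    least [c], beats the error [(1 + 2 K) |lam| M < c] from replacing [y] by [q]. *)
Lemma euler_boundary_conditions (f : R -> R -> R) (A B : R -> R) (lam K M c : R) (n : nat) :
  cont_strip f ->
  (forall t, 0 <= t <= 1 -> Rabs (A t) <= K) -> (forall t, 0 <= t <= 1 -> Rabs (B t) <= K) ->
  (forall t y, 0 <= t <= 1 -> Rabs y <= 2 * K + 3 -> Rabs (f t y) <= M) ->
  Rabs lam * M <= 1 -> (1 + 2 * K) * (Rabs lam * M) < c -> (0 < n)%nat ->
  c <= 1 + mean n (fun k => A (INR k / INR n) - B (INR k / INR n)) ->
  exists p q, Rabs p <= 2 * K + 1 /\ Rabs q <= 1 /\
    p = mean n (fun k => A (INR k / INR n) * euler_y f lam n p q k) /\
    euler_x f lam n p q n = mean n (fun k => B (INR k / INR n) * euler_y f lam n p q k).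
Proof.
  intros Hf HA HB HM Hlam Hc Hn Hcn.
  assert (HK0 : 0 <= K) by (eapply Rle_trans; [apply Rabs_pos | apply (HA 0); lra]).
  set (D k := 1 + (A (INR k / INR n) - B (INR k / INR n))).
  assert (HD : forall k, (k < n)%nat -> Rabs (D k) <= 1 + 2 * K).
  { intros k Hk; assert (Hk01 := grid_in_01 n k (Nat.lt_le_incl _ _ Hk)).
    generalize (proj1 (Rabs_le_between _ _) (HA _ Hk01)) (proj1 (Rabs_le_between _ _) (HB _ Hk01)).
    intros; apply Rabs_le; unfold D; lra. }
  assert (HmD : c <= mean n D) by (unfold D; rewrite mean_plus, mean_const by lia; exact Hcn).
  set (u p q := mean n (fun k => A (INR k / INR n) * euler_y f lam n p q k) - p).
  set (v p q := -1 * mean n (fun k => D k * euler_y f lam n p q k)).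
  assert (Hb : forall p q k, Rabs p <= 2 * K + 1 -> Rabs q <= 1 -> (k < n)%nat ->
    Rabs (euler_y f lam n p q k) <= 2 /\ Rabs (euler_y f lam n p q k - q) <= Rabs lam * M).
  { intros p q k Hp Hq Hk.
    destruct (euler_bounds f lam M (2 * K + 1) n p q k) as [_ H]; auto with arith.
    { intros t y Ht Hy; apply HM; lra. }
    assert (Hk01 := grid_in_01 n k (Nat.lt_le_incl _ _ Hk)).
    assert (HL : 0 <= Rabs lam * M).
    { apply Rmult_le_pos; [apply Rabs_pos|].
      eapply Rle_trans; [apply Rabs_pos | apply (HM 0 0); [lra | rewrite Rabs_R0; lra]]. }
    assert (H1 : Rabs (euler_y f lam n p q k - q) <= Rabs lam * M).
    { eapply Rle_trans; [exact H|].
      rewrite <- (Rmult_1_r (Rabs lam * M)) at 2; apply Rmult_le_compat_l; lra. }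
    split; [|exact H1].
    replace (euler_y f lam n p q k) with ((euler_y f lam n p q k - q) + q) by ring.
    eapply Rle_trans; [apply Rabs_triang|]; lra. }
  assert (Hu : forall p q, Rabs p <= 2 * K + 1 -> Rabs q <= 1 -> Rabs (u p q + p) <= 2 * K).
  { intros p q Hp Hq; unfold u.
    replace (mean n (fun k => A (INR k / INR n) * euler_y f lam n p q k) - p + p)
      with (mean n (fun k => A (INR k / INR n) * euler_y f lam n p q k)) by ring.
    apply mean_bound; [exact Hn|]; intros k Hk; rewrite Rabs_mult, (Rmult_comm 2).
    apply Rmult_le_compat; try apply Rabs_pos; [apply HA, grid_in_01; lia | apply Hb; assumption]. }
  assert (Hv : forall p q, Rabs p <= 2 * K + 1 -> Rabs q <= 1 -> Rabs (v p q + q * mean n D) < c).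
  { intros p q Hp Hq; unfold v.
    replace (-1 * mean n (fun k => D k * euler_y f lam n p q k) + q * mean n D)
      with (-1 * mean n (fun k => D k * (euler_y f lam n p q k - q))).
    - rewrite Rabs_mult, (Rabs_left (-1)) by lra; replace (- -1) with 1 by ring.
      rewrite Rmult_1_l; eapply Rle_lt_trans; [|exact Hc].
      apply mean_bound; [exact Hn|]; intros k Hk; rewrite Rabs_mult.
      apply Rmult_le_compat; try apply Rabs_pos; [apply HD; exact Hk | apply Hb; assumption].
    - rewrite (mean_ext n (fun k => D k * (euler_y f lam n p q k - q))
        (fun k => D k * euler_y f lam n p q k + - q * D k)) by (intros; ring).
      rewrite mean_plus, mean_scal; ring. }
  destruct (poincare_miranda u v (2 * K + 1) 1) as [p [q [Hp [Hq [Hu0 Hv0]]]]]; try lra.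
  - intro z.
    apply (continuous_minus (V := R_NormedModule)
      (fun z => mean n (fun k => A (INR k / INR n) * euler_y f lam n (fst z) (snd z) k)) fst);
      [|destruct z; apply continuous_fst].
    apply (mean_continuous n (fun k z => A (INR k / INR n) * euler_y f lam n (fst z) (snd z) k)).
    intros k Hk; apply (continuous_scal_r (V := R_NormedModule)), euler_continuous; [exact Hf | lia].
  - intro z; apply (continuous_scal_r (V := R_NormedModule)).
    apply (mean_continuous n (fun k z => D k * euler_y f lam n (fst z) (snd z) k)).
    intros k Hk; apply (continuous_scal_r (V := R_NormedModule)), euler_continuous; [exact Hf | lia].
  - intros q Hq.
    assert (H := Hu (- (2 * K + 1)) q ltac:(apply Rabs_le; lra) ltac:(apply Rabs_le; lra)).
    apply Rabs_le_between in H; lra.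
  - intros q Hq.
    assert (H := Hu (2 * K + 1) q ltac:(apply Rabs_le; lra) ltac:(apply Rabs_le; lra)).
    apply Rabs_le_between in H; lra.
  - intros p Hp.
    assert (H := Hv p (Ropp 1) ltac:(apply Rabs_le; lra) ltac:(apply Rabs_le; lra)).
    apply Rabs_def2 in H; lra.
  - intros p Hp.
    assert (H := Hv p 1 ltac:(apply Rabs_le; lra) ltac:(apply Rabs_le; lra)).
    apply Rabs_def2 in H; lra.
  - exists p, q; split; [apply Rabs_le; lra | split; [apply Rabs_le; lra|]].
    assert (E1 : p = mean n (fun k => A (INR k / INR n) * euler_y f lam n p q k)) by (unfold u in Hu0; lra).
    split; [exact E1|].
    rewrite euler_x_sum; rewrite E1 at 1; unfold v, D in Hv0.
    rewrite (mean_ext n _ (fun k => euler_y f lam n p q k +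
      (A (INR k / INR n) * euler_y f lam n p q k + -1 * (B (INR k / INR n) * euler_y f lam n p q k)))) in Hv0
      by (intros; ring).
    rewrite !mean_plus, mean_scal in Hv0; unfold mean in *; lra.
Qed.

(** * Passage to the limit *)

(** One-sided at 0 and 1, because the limit functions are meaningful on [[0, 1]] only; the product
    form also covers [s = t]. *)
Definition has_derivative_in_01 (w : R -> R) (t l : R) : Prop :=
  forall eps, 0 < eps -> exists eta, 0 < eta /\
    forall s, 0 <= s <= 1 -> Rabs (s - t) < eta -> Rabs (w s - w t - l * (s - t)) <= eps * Rabs (s - t).

Definition clamp (t : R) : R := Rmax 0 (Rmin 1 t).

Lemma clamp_in_01 (t : R) : 0 <= clamp t <= 1.
Proof. unfold clamp, Rmax, Rmin; repeat destruct Rle_dec; lra. Qed.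

Lemma clamp_id (t : R) : 0 <= t <= 1 -> clamp t = t.
Proof. intro; unfold clamp, Rmax, Rmin; repeat destruct Rle_dec; lra. Qed.

Lemma clamp_lipschitz (s t : R) : Rabs (clamp s - clamp t) <= Rabs (s - t).
Proof.
  unfold clamp, Rmax, Rmin, Rabs; repeat destruct Rle_dec; repeat destruct Rcase_abs; lra.
Qed.

(** Composing with [clamp] gives continuity on the whole line, and the mean value theorem asks for a
    derivative only at interior points. *)
Lemma zero_derivative_in_01_const (D : R -> R) :
  (forall t, 0 <= t <= 1 -> has_derivative_in_01 D t 0) ->
  forall t, 0 <= t <= 1 -> D t = D 0.
Proof.
  intros HD t Ht.
  assert (Hc : forall r, continuity_pt (fun r => D (clamp r)) r).
  { intro r; apply continuity_pt_filterlim, filterlim_locally; intro e.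
    destruct (HD (clamp r) (clamp_in_01 r) 1 Rlt_0_1) as [eta [He H]].
    exists (mkposreal (Rmin eta e) (Rmin_pos _ _ He (cond_pos e))); intros s Hs.
    change (Rabs (s - r) < Rmin eta e) in Hs; change (Rabs (D (clamp s) - D (clamp r)) < e).
    assert (Hcl := clamp_lipschitz s r).
    specialize (H (clamp s) (clamp_in_01 s)); rewrite Rmult_0_l, Rminus_0_r in H.
    generalize (Rmin_l eta e) (Rmin_r eta e); intros.
    assert (H' := H ltac:(lra)); lra. }
  destruct (MVT_gen (fun r => D (clamp r)) 0 t (fun _ => 0)) as [c [_ E]].
  - rewrite Rmin_left, Rmax_right by lra; intros r Hr; apply is_derive_Reals; intros e He.
    destruct (HD r ltac:(lra) (e / 2) ltac:(lra)) as [eta [Heta H]].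
    assert (Hm : 0 < Rmin eta (Rmin r (1 - r))) by (repeat apply Rmin_pos; lra).
    exists (mkposreal _ Hm); intros h Hh Hlt; simpl in Hlt.
    assert (Hlt' : Rabs h < eta /\ Rabs h < r /\ Rabs h < 1 - r).
    { revert Hlt; unfold Rmin; repeat destruct Rle_dec; lra. }
    destruct Hlt' as [L1 [L2 L3]]; apply Rabs_def2 in L2; apply Rabs_def2 in L3.
    rewrite !clamp_id by lra.
    specialize (H (r + h) ltac:(lra)); replace (r + h - r) with h in H by ring.
    specialize (H L1); rewrite Rmult_0_l, Rminus_0_r in H.
    assert (0 < Rabs h) by (apply Rabs_pos_lt; exact Hh).
    rewrite Rminus_0_r; unfold Rdiv; rewrite Rabs_mult, Rabs_inv.
    apply Rmult_lt_reg_r with (Rabs h); [assumption|].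
    rewrite Rmult_assoc, Rinv_l, Rmult_1_r by lra; nra.
  - intros; apply Hc.
  - rewrite !clamp_id in E by lra; lra.
Qed.

(** [is_solution] wants derivatives on all of R, so [w] is replaced by [w 0] plus the integral of
    [h]; on [[0, 1]] the difference of the two has zero derivative and vanishes at 0. *)
Lemma extend_primitive (w h : R -> R) :
  (forall t, continuous h t) ->
  (forall t, 0 <= t <= 1 -> has_derivative_in_01 w t (h t)) ->
  exists W, (forall t, is_derive W t (h t)) /\ forall t, 0 <= t <= 1 -> W t = w t.
Proof.
  intros Hh Hw; exists (fun t => w 0 + RInt h 0 t).
  assert (HW : forall t, is_derive (fun t => w 0 + RInt h 0 t) t (h t)).
  { intro t; rewrite <- (Rplus_0_l (h t)).
    apply (is_derive_plus (K := R_AbsRing) (V := R_NormedModule) (fun _ => w 0) (fun t => RInt h 0 t) t 0 (h t)).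
    - exact (is_derive_const (K := R_AbsRing) (V := R_NormedModule) (w 0) t).
    - apply (is_derive_RInt h (fun t => RInt h 0 t) 0 t); [|apply Hh].
      apply filter_forall; intro s; apply (RInt_correct (V := R_CompleteNormedModule)).
      apply (ex_RInt_continuous (V := R_CompleteNormedModule)); intros; apply Hh. }
  split; [exact HW|]; intros t Ht.
  assert (E := zero_derivative_in_01_const (fun t => w 0 + RInt h 0 t - w t)).
  cut (w 0 + RInt h 0 t - w t = w 0 + RInt h 0 0 - w 0).
  { rewrite RInt_point; unfold zero; simpl; lra. }
  apply E; [|exact Ht]; clear t Ht E; intros t Ht e He.
  destruct (Hw t Ht (e / 2) ltac:(lra)) as [d1 [Hd1 H1]].
  destruct (proj1 (is_derive_Reals _ _ _) (HW t) (e / 2) ltac:(lra)) as [d2 H2].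
  exists (Rmin d1 d2); split; [apply Rmin_pos; [exact Hd1 | apply cond_pos]|].
  intros s Hs Hst.
  specialize (H1 s Hs (Rlt_le_trans _ _ _ Hst (Rmin_l _ _))).
  destruct (Req_dec s t) as [->|Hne].
  { rewrite !Rminus_diag, Rmult_0_r, Rminus_0_r, Rabs_R0; lra. }
  specialize (H2 (s - t) ltac:(lra) (Rlt_le_trans _ _ _ Hst (Rmin_r _ _))).
  replace (t + (s - t)) with s in H2 by ring.
  set (Ws := w 0 + RInt h 0 s) in *; set (Wt := w 0 + RInt h 0 t) in *.
  assert (Hp : 0 < Rabs (s - t)) by (apply Rabs_pos_lt; lra).
  assert (H3 : Rabs (Ws - Wt - h t * (s - t)) <= e / 2 * Rabs (s - t)).
  { replace (Ws - Wt - h t * (s - t)) with (((Ws - Wt) / (s - t) - h t) * (s - t)) by (field; lra).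
    rewrite Rabs_mult; apply Rmult_le_compat_r; lra. }
  replace (Ws - w s - (Wt - w t) - 0 * (s - t))
    with ((Ws - Wt - h t * (s - t)) + - (w s - w t - h t * (s - t))) by ring.
  eapply Rle_trans; [apply Rabs_triang|]; rewrite Rabs_Ropp; lra.
Qed.

(** The equicontinuity half of Arzela-Ascoli: the limit at [t] is known along a single index per
    [n], and the common Lipschitz constant spreads it to all grid points near [t]. Two such points
    are at most [2 eta] apart, and [2 L eta <= eps / 2]. *)
Lemma lipschitz_array_near (Z : nat -> nat -> R) (L : R) (z : R -> R) (t eps : R) :
  0 <= L ->
  U (fun n => forall j k, (j <= k <= n)%nat ->
     Rabs (Z n k - Z n j) <= L * ((INR k - INR j) / INR n)) ->
  is_ulim (fun n => Z n (ceil_index n t)) (z t) ->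
  0 <= t <= 1 -> 0 < eps -> exists eta, 0 < eta /\
    U (fun n => forall k, (k <= n)%nat -> Rabs (INR k / INR n - t) < eta -> Rabs (Z n k - z t) < eps).
Proof.
  intros HL HZ Hz Ht He.
  set (eta := eps / (4 * (L + 1))).
  assert (Heta : 0 < eta) by (apply Rdiv_lt_0_compat; lra).
  exists eta; split; [exact Heta|].
  generalize (U_and _ _ HZ (U_and _ _ (proj1 (is_ulim_eps _ _) Hz (eps / 2) ltac:(lra))
    (U_and _ _ U_INR_pos (U_inv_INR_lt eta Heta)))).
  apply filter_imp; intros n [H1 [H2 [H3 H4]]] k Hk Hkt.
  assert (Hm := ceil_index_le_n n t Ht); destruct (ceil_index_spec n t ltac:(lra)) as [H5 H6].
  set (m := ceil_index n t) in *.
  assert (Hmt : Rabs (INR m / INR n - t) < eta).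
  { replace (INR m / INR n - t) with ((INR m - INR n * t) * / INR n) by (field; lra).
    assert (0 < / INR n) by (apply Rinv_0_lt_compat; lra).
    rewrite Rabs_pos_eq; nra. }
  assert (Hkm : Rabs (Z n k - Z n m) <= L * Rabs (INR k / INR n - INR m / INR n)).
  { destruct (Nat.le_ge_cases m k) as [C|C].
    - eapply Rle_trans; [apply H1; lia|]; apply Rmult_le_compat_l; [exact HL|].
      eapply Rle_trans; [|apply Rle_abs]; right; field; lra.
    - rewrite Rabs_minus_sym; eapply Rle_trans; [apply H1; lia|]; apply Rmult_le_compat_l; [exact HL|].
      rewrite Rabs_minus_sym; eapply Rle_trans; [|apply Rle_abs]; right; field; lra. }
  apply Rabs_def2 in Hkt; apply Rabs_def2 in Hmt; apply Rabs_def2 in H2.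
  assert (Hd : Rabs (INR k / INR n - INR m / INR n) <= 2 * eta) by (apply Rabs_le; lra).
  assert (HLe : L * (2 * eta) <= eps / 2).
  { apply Rle_trans with ((L + 1) * (2 * eta)); [apply Rmult_le_compat_r; lra|].
    right; unfold eta; field; lra. }
  assert (Rabs (Z n k - Z n m) <= eps / 2).
  { eapply Rle_trans; [exact Hkm|]; eapply Rle_trans; [|exact HLe].
    apply Rmult_le_compat_l; assumption. }
  apply Rabs_le_between in H; apply Rabs_def1; lra.
Qed.

Lemma lipschitz_partial_mean (n j k : nat) (F : nat -> R) (c C : R) :
  (0 < n)%nat -> (j <= k <= n)%nat -> (forall i, (i < n)%nat -> Rabs (F i) <= C) ->
  Rabs (c + / INR n * fsum k F - (c + / INR n * fsum j F)) <= C * ((INR k - INR j) / INR n).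
Proof.
  intros Hn Hjk HF; assert (0 < INR n) by (apply lt_0_INR; lia).
  assert (0 < / INR n) by (apply Rinv_0_lt_compat; lra).
  replace (c + / INR n * fsum k F - (c + / INR n * fsum j F))
    with (/ INR n * (fsum k F - fsum j F)) by ring.
  replace (C * ((INR k - INR j) / INR n)) with (/ INR n * ((INR k - INR j) * C)) by (field; lra).
  rewrite Rabs_mult, (Rabs_pos_eq (/ INR n)) by lra.
  apply Rmult_le_compat_l; [lra|].
  apply fsum_between; [lia | intros; apply HF; lia].
Qed.

Lemma ulim_has_derivative (G : nat -> nat -> R) (P : nat -> R) (w : R -> R) (t l : R) :
  0 <= t <= 1 ->
  (forall s, 0 <= s <= 1 -> is_ulim (fun n => P n + partial_mean n (G n) s) (w s)) ->
  (forall eps, 0 < eps -> exists eta, 0 < eta /\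
     U (fun n => forall k, (k < n)%nat -> Rabs (INR k / INR n - t) < eta -> Rabs (G n k - l) < eps)) ->
  has_derivative_in_01 w t l.
Proof.
  intros Ht Hw HG e He; destruct (HG e He) as [eta [Heta H]].
  exists eta; split; [exact Heta|]; intros s Hs Hst.
  assert (HGU : forall a b, 0 <= a <= b -> b <= 1 -> t - eta < a -> b < t + eta ->
    Rabs (w b - w a - l * (b - a)) <= (b - a) * e).
  { intros a b Hab Hb Ha' Hb'; apply (partial_mean_increment G P); [lra | apply Hw; lra | apply Hw; lra |].
    revert H; apply filter_imp; intros n Hn k Hk Hkn; left; apply Hn.
    - assert (Hc := ceil_index_le_n n b ltac:(lra)); lia.
    - apply Rabs_def1; lra. }
  apply Rabs_def2 in Hst; destruct (Rle_dec t s) as [C|C].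
  - rewrite (Rabs_pos_eq (s - t)), (Rmult_comm e) by lra; apply HGU; lra.
  - rewrite (Rabs_left (s - t)) by lra.
    replace (w s - w t - l * (s - t)) with (- (w t - w s - l * (t - s))) by ring.
    rewrite Rabs_Ropp; eapply Rle_trans; [apply HGU; lra | right; ring].
Qed.

Lemma has_derivative_in_01_continuous (w : R -> R) (t l : R) :
  has_derivative_in_01 w t l -> forall eps, 0 < eps -> exists eta, 0 < eta /\
    forall s, 0 <= s <= 1 -> Rabs (s - t) < eta -> Rabs (w s - w t) < eps.
Proof.
  intros H e He; destruct (H 1 Rlt_0_1) as [eta [Heta Hw]].
  assert (Hl := Rabs_pos l).
  exists (Rmin eta (e / (Rabs l + 2))); split.
  { apply Rmin_pos; [exact Heta | apply Rdiv_lt_0_compat; lra]. }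
  intros s Hs Hst.
  assert (H1 := Hw s Hs (Rlt_le_trans _ _ _ Hst (Rmin_l _ _))).
  assert (H2 := Rlt_le_trans _ _ _ Hst (Rmin_r _ _)).
  replace (w s - w t) with ((w s - w t - l * (s - t)) + l * (s - t)) by ring.
  eapply Rle_lt_trans; [apply Rabs_triang|]; rewrite (Rabs_mult l).
  apply Rle_lt_trans with ((Rabs l + 1) * Rabs (s - t)); [lra|].
  apply Rle_lt_trans with ((Rabs l + 1) * (e / (Rabs l + 2))).
  - apply Rmult_le_compat_l; lra.
  - apply Rlt_le_trans with ((Rabs l + 2) * (e / (Rabs l + 2))).
    + apply Rmult_lt_compat_r; [apply Rdiv_lt_0_compat; lra | lra].
    + right; field; lra.
Qed.

(** [RS_integral_ulim] with slopes 1 and [x t = t]: [I] is first taken as an ultralimit of the means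
    and only then recognised as the integral. *)
Lemma is_ulim_mean_RInt (D : R -> R) :
  osc_small D -> bounded_on D 0 1 ->
  is_ulim (fun n => mean n (fun k => D (INR k / INR n))) (RInt D 0 1).
Proof.
  intros HD HB; destruct (HB) as [K HK].
  destruct (is_ulim_bounded (fun n => mean n (fun k => D (INR k / INR n))) (-K) K) as [I [_ HI]].
  { generalize (U_ge 1); apply filter_imp; intros n Hn; apply Rabs_le_between, mean_bound; [lia|].
    intros k Hk; apply HK, grid_in_01; lia. }
  replace (RInt D 0 1) with I; [exact HI|].
  symmetry; apply is_RInt_unique, RS_integral_id_RInt.
  apply (RS_integral_ulim D (fun _ _ => 1) (fun _ => 0) (fun t => t) 1 I); try assumption.
  - intros; rewrite Rabs_R1; lra.
  - intros t Ht; apply (is_ulim_ext (fun n => INR (ceil_index n t) / INR n)).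
    + apply filter_forall; intro n; unfold partial_mean; rewrite fsum_const; unfold Rdiv; ring.
    + apply is_ulim_ceil_index; lra.
  - apply (is_ulim_ext (fun n => mean n (fun k => D (INR k / INR n)))); [|exact HI].
    apply filter_forall; intro n; apply mean_ext; intros; ring.
Qed.

Theorem theorem4p16 (f : R -> R -> R) (A B : R -> R) :
  cont_strip f -> OmegaHat01 A -> OmegaHat01 B ->
  Rabs (RInt (fun s => A s - B s) 0 1) < 1 ->
  exists lam0, 0 < lam0 /\
    forall lam, Rabs lam <= lam0 -> exists x, is_solution f A B lam x.
Proof.
  intros Hf HA HB HAB.
  assert (OA := OmegaHat01_osc_small A HA); assert (OB := OmegaHat01_osc_small B HB).
  assert (BA := OmegaHat01_bounded A HA); assert (BB := OmegaHat01_bounded B HB).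
  destruct (BA) as [KA HKA]; destruct (BB) as [KB HKB].
  set (K := Rmax KA KB).
  assert (HA' : forall t, 0 <= t <= 1 -> Rabs (A t) <= K).
  { intros t Ht; apply Rle_trans with KA; [auto | apply Rmax_l]. }
  assert (HB' : forall t, 0 <= t <= 1 -> Rabs (B t) <= K).
  { intros t Ht; apply Rle_trans with KB; [auto | apply Rmax_r]. }
  assert (HK0 : 0 <= K) by (eapply Rle_trans; [apply Rabs_pos | apply (HA' 0); lra]).
  destruct (cont_strip_bounded f (2 * K + 3) Hf) as [M [HM0 HM]].
  set (I := RInt (fun s => A s - B s) 0 1) in *; apply Rabs_def2 in HAB.
  (* Strictly between 0 and [1 + I], so [1 + mean (A - B) >= c] for [U]-almost all [n]; the
     smallness of [lam] then depends on [c] and not on [n]. *)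
  set (c := (1 + I) / 2).
  assert (Hc : 0 < c < 1 + I) by (unfold c; lra).
  assert (HmI : is_ulim (fun n => mean n (fun k => A (INR k / INR n) - B (INR k / INR n))) I).
  { apply (is_ulim_mean_RInt (fun s => A s - B s)); [apply osc_small_minus; assumption|].
    exists (2 * K); intros t Ht; unfold Rminus; eapply Rle_trans; [apply Rabs_triang|].
    rewrite Rabs_Ropp; generalize (HA' t Ht) (HB' t Ht); lra. }
  assert (Hcn : U (fun n => c <= 1 + mean n (fun k => A (INR k / INR n) - B (INR k / INR n)))).
  { generalize (proj1 (is_ulim_eps _ _) HmI (1 + I - c) ltac:(lra)); apply filter_imp.
    intros n Hn; apply Rabs_def2 in Hn; lra. }
  (* [r <= 1] serves [|lam| M <= 1] and [r < c] serves the sign condition in [q]; dividing by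
     [(1 + 2 K) (M + 1)] below gives [(1 + 2 K) |lam| M <= r]. *)
  set (r := Rmin 1 (c / 2)).
  assert (Hr : 0 < r /\ r <= 1 /\ r < c) by (unfold r, Rmin; destruct Rle_dec; lra).
  assert (HQ : 0 < (1 + 2 * K) * (M + 1)) by (apply Rmult_lt_0_compat; lra).
  exists (r / ((1 + 2 * K) * (M + 1))); split; [apply Rdiv_lt_0_compat; lra|].
  intros lam Hlam.
  assert (Hlam0 := Rabs_pos lam).
  assert (HlM0 : 0 <= Rabs lam * M) by (apply Rmult_le_pos; lra).
  assert (HlM : (1 + 2 * K) * (Rabs lam * M) <= r).
  { apply (Rmult_le_compat_r ((1 + 2 * K) * (M + 1))) in Hlam; [|lra].
    replace (r / ((1 + 2 * K) * (M + 1)) * ((1 + 2 * K) * (M + 1))) with r in Hlam by (field; lra).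
    assert (0 <= (1 + 2 * K) * Rabs lam) by (apply Rmult_le_pos; lra); nra. }
  assert (HlM1 : Rabs lam * M <= 1) by nra.
  assert (Hpq : forall n, exists pq : R * R, Rabs (fst pq) <= 2 * K + 1 /\ Rabs (snd pq) <= 1 /\
    ((0 < n)%nat -> c <= 1 + mean n (fun k => A (INR k / INR n) - B (INR k / INR n)) ->
     fst pq = mean n (fun k => A (INR k / INR n) * euler_y f lam n (fst pq) (snd pq) k) /\
     euler_x f lam n (fst pq) (snd pq) n =
       mean n (fun k => B (INR k / INR n) * euler_y f lam n (fst pq) (snd pq) k))).
  { intro n.
    destruct (classic ((0 < n)%nat /\ c <= 1 + mean n (fun k => A (INR k / INR n) - B (INR k / INR n))))
      as [[H1 H2]|H].
    - destruct (euler_boundary_conditions f A B lam K M c n) as [p [q [Hp [Hq HE]]]]; try assumption; [lra|].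
      exists (p, q); auto.
    (* For the exceptional [n] any pair in the rectangle will do: the bounds hold for it, and the
       boundary equations are claimed only under their premises. *)
    - exists (0, 0); simpl; rewrite Rabs_R0; split; [lra | split; [lra | intros; tauto]]. }
  destruct (choice _ Hpq) as [pq Hpq']; clear Hpq.
  set (x_ n := euler_x f lam n (fst (pq n)) (snd (pq n))).
  set (y_ n := euler_y f lam n (fst (pq n)) (snd (pq n))).
  set (g_ n := euler_g f lam n (fst (pq n)) (snd (pq n))).
  assert (Hxs : forall n k, x_ n k = fst (pq n) + / INR n * fsum k (y_ n)) by (intros; apply euler_x_sum).
  assert (Hys : forall n k, y_ n k = snd (pq n) + / INR n * fsum k (g_ n)) by (intros; apply euler_y_sum).
  assert (Hbd : forall n k, (k <= n)%nat -> (0 < n)%nat ->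
    Rabs (x_ n k) <= 2 * K + 3 /\ Rabs (y_ n k) <= 2).
  { intros n k Hk Hn; destruct (Hpq' n) as [Hp [Hq _]].
    destruct (euler_bounds f lam M (2 * K + 1) n (fst (pq n)) (snd (pq n)) k) as [H1 H2]; try assumption.
    { intros; apply HM; lra. }
    assert (H3 := grid_in_01 n k Hk).
    split; [unfold x_; lra|].
    replace (y_ n k) with ((y_ n k - snd (pq n)) + snd (pq n)) by ring.
    eapply Rle_trans; [apply Rabs_triang|].
    assert (Rabs lam * M * (INR k / INR n) <= 1 * 1) by (apply Rmult_le_compat; lra).
    unfold y_ at 1; lra. }
  assert (Hyb : forall n k, (k < n)%nat -> Rabs (y_ n k) <= 2) by (intros; apply Hbd; lia).
  assert (Hgb : forall n k, (k < n)%nat -> Rabs (g_ n k) <= 1).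
  { intros n k Hk; unfold g_, euler_g; rewrite Rabs_mult, Rabs_Ropp.
    eapply Rle_trans; [|exact HlM1]; apply Rmult_le_compat_l; [exact Hlam0|].
    apply HM; [apply grid_in_01; lia | apply (Hbd n k); lia]. }
  assert (Hlim : forall (Z : nat -> nat -> R) C,
    (forall n k, (k <= n)%nat -> (0 < n)%nat -> Rabs (Z n k) <= C) ->
    exists z : R -> R, forall t, 0 <= t <= 1 -> is_ulim (fun n => Z n (ceil_index n t)) (z t)).
  { intros Z C HZ.
    apply (choice (fun t l => 0 <= t <= 1 -> is_ulim (fun n => Z n (ceil_index n t)) l)).
    intro t; destruct (classic (0 <= t <= 1)) as [Ht|Ht]; [|exists 0; contradiction].
    destruct (is_ulim_bounded (fun n => Z n (ceil_index n t)) (-C) C) as [l [_ Hl]]; [|exists l; auto].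
    generalize (U_ge 1); apply filter_imp; intros n Hn; apply Rabs_le_between, HZ; [|lia].
    apply ceil_index_le_n; exact Ht. }
  destruct (Hlim x_ (2 * K + 3)) as [x Hx]; [intros; apply Hbd; assumption|].
  destruct (Hlim y_ 2) as [y Hy]; [intros; apply Hbd; assumption|].
  clear Hlim.
  assert (Hx' : forall t, 0 <= t <= 1 -> is_ulim (fun n => fst (pq n) + partial_mean n (y_ n) t) (x t)).
  { intros t Ht; apply (is_ulim_ext _ _ _ (filter_forall _ (fun n => Hxs n _)) (Hx t Ht)). }
  assert (Hy' : forall t, 0 <= t <= 1 -> is_ulim (fun n => snd (pq n) + partial_mean n (g_ n) t) (y t)).
  { intros t Ht; apply (is_ulim_ext _ _ _ (filter_forall _ (fun n => Hys n _)) (Hy t Ht)). }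
  assert (Lx : U (fun n => forall j k, (j <= k <= n)%nat ->
     Rabs (x_ n k - x_ n j) <= 2 * ((INR k - INR j) / INR n))).
  { generalize (U_ge 1); apply filter_imp; intros n Hn j k Hjk; rewrite !Hxs.
    apply lipschitz_partial_mean; auto. }
  assert (Ly : U (fun n => forall j k, (j <= k <= n)%nat ->
     Rabs (y_ n k - y_ n j) <= 1 * ((INR k - INR j) / INR n))).
  { generalize (U_ge 1); apply filter_imp; intros n Hn j k Hjk; rewrite !Hys.
    apply lipschitz_partial_mean; auto. }
  assert (Dx : forall t, 0 <= t <= 1 -> has_derivative_in_01 x t (y t)).
  { intros t Ht; apply (ulim_has_derivative y_ (fun n => fst (pq n))); [exact Ht | exact Hx' |].
    intros e He; destruct (lipschitz_array_near y_ 1 y t e ltac:(lra) Ly (Hy t Ht) Ht He) as [eta [Heta H]].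
    exists eta; split; [exact Heta|]; revert H; apply filter_imp; intros n Hn k Hk; apply Hn; lia. }
  assert (Dy : forall t, 0 <= t <= 1 -> has_derivative_in_01 y t (- lam * f t (x t))).
  { intros t Ht; apply (ulim_has_derivative g_ (fun n => snd (pq n))); [exact Ht | exact Hy' |].
    intros e He.
    destruct (cont_strip_eps f t (x t) (e / (Rabs lam + 1)) Hf Ht) as [d [Hd Hfd]];
      [apply Rdiv_lt_0_compat; lra|].
    destruct (lipschitz_array_near x_ 2 x t d ltac:(lra) Lx (Hx t Ht) Ht Hd) as [eta [Heta H]].
    (* [d] controls the time argument of [f], [eta] keeps the polygon within [d] of [x t]. *)
    exists (Rmin eta d); split; [apply Rmin_pos; assumption|].
    revert H; apply filter_imp; intros n Hn k Hk Hkt.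
    specialize (Hn k ltac:(lia) (Rlt_le_trans _ _ _ Hkt (Rmin_l _ _))).
    specialize (Hfd _ _ (grid_in_01 n k (Nat.lt_le_incl _ _ Hk)) (Rlt_le_trans _ _ _ Hkt (Rmin_r _ _)) Hn).
    change (g_ n k) with (- lam * f (INR k / INR n) (x_ n k)).
    rewrite <- Rmult_minus_distr_l, Rabs_mult, Rabs_Ropp.
    apply Rle_lt_trans with (Rabs lam * (e / (Rabs lam + 1))).
    - apply Rmult_le_compat_l; lra.
    - apply Rlt_le_trans with ((Rabs lam + 1) * (e / (Rabs lam + 1))).
      + apply Rmult_lt_compat_r; [apply Rdiv_lt_0_compat|]; lra.
      + right; field; lra. }
  (* Frozen outside [[0, 1]], the right-hand side is continuous on all of R; integrating it twice
     gives the global [Y] and [X]. *)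
  set (h t := - lam * f (clamp t) (x (clamp t))).
  assert (Hh : forall t, continuous h t).
  { intro t; apply (continuous_scal_r (V := R_NormedModule)), filterlim_locally; intro e.
    assert (Ht := clamp_in_01 t).
    destruct (cont_strip_eps f _ (x (clamp t)) e Hf Ht (cond_pos e)) as [d [Hd Hfd]].
    destruct (has_derivative_in_01_continuous _ _ _ (Dx _ Ht) d Hd) as [eta [Heta Hxc]].
    exists (mkposreal _ (Rmin_pos _ _ Hd Heta)); intros s Hs.
    change (Rabs (s - t) < Rmin d eta) in Hs.
    assert (Hst := Rle_lt_trans _ _ _ (clamp_lipschitz s t) Hs).
    apply Hfd; [apply clamp_in_01 | exact (Rlt_le_trans _ _ _ Hst (Rmin_l _ _)) |].
    apply Hxc; [apply clamp_in_01 | exact (Rlt_le_trans _ _ _ Hst (Rmin_r _ _))]. }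
  destruct (extend_primitive y h Hh) as [Y [DY EY]].
  { intros t Ht; unfold h; rewrite clamp_id by exact Ht; auto. }
  destruct (extend_primitive x Y) as [X [DX EX]].
  { intro t; apply (ex_derive_continuous (V := R_NormedModule)); exists (h t); apply DY. }
  { intros t Ht; rewrite EY by exact Ht; auto. }
  assert (E1 : forall t, Derive X t = Y t) by (intro; apply is_derive_unique, DX).
  assert (E2 : forall t, Derive (Derive X) t = h t).
  { intro t; rewrite (Derive_ext (Derive X) Y t E1); apply is_derive_unique, DY. }
  assert (HX : forall t, 0 <= t <= 1 -> is_ulim (fun n => fst (pq n) + partial_mean n (y_ n) t) (X t)).
  { intros t Ht; rewrite EX by exact Ht; auto. }
  assert (Hbc : U (fun n => fst (pq n) = mean n (fun k => A (INR k / INR n) * y_ n k) /\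
                            x_ n n = mean n (fun k => B (INR k / INR n) * y_ n k))).
  { generalize (U_and _ _ (U_ge 1) Hcn); apply filter_imp; intros n [Hn Hc'].
    apply Hpq'; [lia | exact Hc']. }
  exists X; split; [|split; [|split]].
  - intro t; split; [exists (Y t); apply DX | split].
    + apply (ex_derive_ext Y); [intro; symmetry; apply E1 | exists (h t); apply DY].
    + apply (continuous_ext h); [intro; symmetry; apply E2 | apply Hh].
  - intros t Ht; rewrite E2, EX by exact Ht; unfold h; rewrite clamp_id by exact Ht; reflexivity.
  (* At [t = 0] the partial mean is empty, so [X 0] is the limit of the initial values, which equal
     the means of [A y]; at [t = 1] it is complete and the sum is the endpoint of the polygon. *)
  - apply (RS_integral_ulim A y_ (fun n => fst (pq n)) X 2); try assumption.
    apply (is_ulim_ext (fun n => fst (pq n) + partial_mean n (y_ n) 0)); [|apply HX; lra].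
    revert Hbc; apply filter_imp; intros n [H _]; rewrite partial_mean_0, <- H; ring.
  - apply (RS_integral_ulim B y_ (fun n => fst (pq n)) X 2); try assumption.
    apply (is_ulim_ext (fun n => fst (pq n) + partial_mean n (y_ n) 1)); [|apply HX; lra].
    revert Hbc; apply filter_imp; intros n [_ H]; rewrite partial_mean_1, <- H, Hxs; reflexivity.
Qed.
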